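(* Let $\mathbb{F}_\ell$ be a finite field, $F=\mathbb{F}_\ell((t))$, $n\ge1$, and let $p:\underline{\mathfrak g}=\mathfrak{gl}_n\to\underline{\mathfrak c}$ be the Chevalley map over $\mathbb{F}_\ell$. Let $i\in\mathbb{N}$ and let $\underline{\mathfrak g}_i=\underline{\mathfrak g}\times_{\underline{\mathfrak c}}\cdots\times_{\underline{\mathfrak c}}\underline{\mathfrak g}$ ($i$ times, with respect to $p$). Assume that the variety $\underline{\mathfrak g}_i$ admits a strong resolution of singularities. Let $\mu^{\mathfrak c}$ be a Haar measure on $\mathfrak c:=\underline{\mathfrak c}(F)$. Then for any smooth compactly supported measure $\mu$ on $\mathfrak g:=\underline{\mathfrak g}(F)$ there exists a function $$f\in\bigcap_{r\in[1,i)}L^{r}(\mathfrak c)$$ such that $p_*(\mu)=f\mu^{\mathfrak c}$.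
   Context: A variety is a reduced scheme of finite type over a field (here $\mathbb{F}_\ell$). $\underline{\mathfrak c}$ is the affine space of monic polynomials of degree $n$, identified with $\mathbb{A}^n$ (via coefficients), and $p$ sends a matrix to its characteristic polynomial. The scheme $\underline{\mathfrak g}_i$ is reduced, so it is a variety. A strong resolution of singularities of a variety $\mathbf{X}$ is a proper birational map $\phi:\tilde{\mathbf X}\to\mathbf{X}$ such that $\tilde{\mathbf X}$ is smooth, $\phi$ is an isomorphism over the smooth locus $\mathbf{X}^{sm}$, and the inverse image in $\tilde{\mathbf X}$ of the singular locus $\mathbf{X}^{sing}$, considered as a (reduced) variety, is a strict normal crossings divisor. A smooth measure on $F^N$ is a locally constant function times a Haar measure. $L^r(\mathfrak c)$ is taken with respect to $\mu^{\mathfrak c}$. *)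

(* Defs.v *)
From HB Require Import structures.
From mathcomp Require Import all_boot all_order all_algebra.
From mathcomp Require Import fraction complex.
From mathcomp Require Import all_classical all_reals all_analysis.

Set Implicit Arguments.
Unset Strict Implicit.
Unset Printing Implicit Defensive.

Import Order.TTheory GRing.Theory Num.Theory.
Import numFieldNormedType.Exports.

Local Open Scope classical_set_scope.
Local Open Scope ring_scope.
Local Open Scope complex_scope.

Section CommutativeAlgebra.
Variable A : comNzRingType.
Implicit Types (I P S : set A).

Definition is_ideal I :=
  [/\ I 0, forall a b, I a -> I b -> I (a + b) & forall a b, I b -> I (a * b)].

Definition ideal_gen S : set A :=
  [set a | forall I, is_ideal I -> S `<=` I -> I a].

Definition is_prime_ideal P :=
  [/\ is_ideal P, ~ P 1 & forall a b, P (a * b) -> P a \/ P b].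

Definition invertible (a : A) := exists b, a * b = 1.

Definition is_field := forall a : A, a <> 0 -> invertible a.

Definition is_reduced_ring := forall (a : A) n, a ^+ n = 0 -> a = 0.

Definition prime_chain m := exists P : nat -> set A,
  (forall j, (j <= m)%N -> is_prime_ideal (P j)) /\
  (forall j, (j < m)%N -> P j `<=` P j.+1 /\ P j <> P j.+1).

Definition krull_dim d := prime_chain d /\ forall m, prime_chain m -> (m <= d)%N.

End CommutativeAlgebra.

Section Localization.
Variables (k : fieldType) (A B : comAlgType k).

Definition is_localization (S : set A) (phi : {lrmorphism A -> B}) :=
  [/\ forall s, S s -> invertible (phi s),
      forall b, exists a s, S s /\ b * phi s = phi a
    & forall a, phi a = 0 -> exists2 s, S s & s * a = 0].

End Localization.

Definition finitely_generated_algebra (k : fieldType) (A : comAlgType k) :=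
  exists s : seq A, forall P : set A,
    (forall c : k, P c%:A) -> (forall a b, P a -> P b -> P (a + b)) ->
    (forall a b, P a -> P b -> P (a * b)) -> (forall a, a \in s -> P a) ->
    forall a, P a.

(* Schemes over [k] are functors of points in the sense of Demazure and Gabriel:
   Zariski sheaves covered by affine open subfunctors.
   [comAlgType k] contains only nonzero algebras. This loses nothing: a Zariski
   sheaf takes a one-point value on the zero ring, so it is determined by its
   restriction to nonzero algebras. The empty scheme is the functor with empty
   values. *)

Record kfunctor (k : fieldType) := KFunctor {
  pts :> comAlgType k -> Type;
  fmap : forall A B : comAlgType k, {lrmorphism A -> B} -> pts A -> pts B;
  fmap_id : forall (A : comAlgType k) (x : pts A),
    fmap (idfun : {lrmorphism A -> A}) x = x;
  fmap_comp : forall (A B C : comAlgType k) (f : {lrmorphism A -> B})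
      (g : {lrmorphism B -> C}) (x : pts A),
    fmap (g \o f : {lrmorphism A -> C}) x = fmap g (fmap f x) }.

Record kmorphism (k : fieldType) (X Y : kfunctor k) := KMorphism {
  on_pts : forall A : comAlgType k, X A -> Y A;
  on_pts_nat : forall (A B : comAlgType k) (f : {lrmorphism A -> B}) (x : X A),
    on_pts (fmap f x) = fmap f (on_pts x) }.

Arguments on_pts {k X Y} _ {A} _.

Section FibreProduct.
Variables (k : fieldType) (X Y Z : kfunctor k).
Variables (f : kmorphism X Y) (g : kmorphism Z Y).

Definition fprod_pts (A : comAlgType k) := {z : X A * Z A | on_pts f z.1 = on_pts g z.2}.

Definition fprod_map (A B : comAlgType k) (h : {lrmorphism A -> B})
    (z : fprod_pts A) : fprod_pts B.
Proof.
exists (fmap h (sval z).1, fmap h (sval z).2).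
by rewrite /= !on_pts_nat (svalP z).
Defined.

Definition fprod : kfunctor k.
Proof.
apply: (@KFunctor k fprod_pts fprod_map) => [A | A B C u v] [[x z] e];
  by apply: eq_exist; rewrite /= ?fmap_id ?fmap_comp.
Defined.

Definition fprod_snd : kmorphism fprod Z.
Proof. by exists (fun A (z : fprod A) => (sval z).2). Defined.

End FibreProduct.

(* The [i]-fold fibre power X x_Y ... x_Y X; it is [Y] itself for [i = 0]. *)
Section FibrePower.
Variables (k : fieldType) (X Y : kfunctor k) (f : kmorphism X Y) (i : nat).

Definition fpow_pts (A : comAlgType k) :=
  {z : Y A * ('I_i -> X A) | forall j, on_pts f (z.2 j) = z.1}.

Definition fpow_map (A B : comAlgType k) (h : {lrmorphism A -> B})
    (z : fpow_pts A) : fpow_pts B.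
Proof.
exists (fmap h (sval z).1, fun j => fmap h ((sval z).2 j)).
by move=> j; rewrite /= on_pts_nat (svalP z).
Defined.

Definition fpow : kfunctor k.
Proof.
apply: (@KFunctor k fpow_pts fpow_map) => [A | A B C u v] [[x z] e];
  apply: eq_exist; rewrite /= ?fmap_id ?fmap_comp; congr pair;
  by apply/funext => j; rewrite ?fmap_id ?fmap_comp.
Defined.

End FibrePower.

Section Schemes.
Variable k : fieldType.
Implicit Types (X Y Z : kfunctor k).

Definition subset_of X := forall A : comAlgType k, set (X A).

Definition full X : subset_of X := fun A => setT.

Definition preimage_of X Y (f : kmorphism X Y) (U : subset_of Y) : subset_of X :=
  fun A => [set x | U A (on_pts f x)].

(* [U] is an open subfunctor: its pullback along every [x : X A] is the open
   subscheme of Spec A where some ideal I of A generates the unit ideal. Stability of [U] under [fmap]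
   follows, by taking [phi] to be the identity. *)
Definition open_sub X (U : subset_of X) :=
  forall (A : comAlgType k) (x : X A), exists2 I : set A, is_ideal I &
    forall (B : comAlgType k) (phi : {lrmorphism A -> B}),
      U B (fmap phi x) <-> ideal_gen (phi @` I) 1.

(* [u] exhibits [V] as an open subfunctor of [X] isomorphic to Spec [A]. *)
Definition affine_open X (V : subset_of X) (A : comAlgType k) (u : X A) :=
  [/\ open_sub V, V A u &
    forall (B : comAlgType k) (x : X B), V B x ->
      exists2 phi : {lrmorphism A -> B}, fmap phi u = x &
        forall psi : {lrmorphism A -> B}, fmap psi u = x -> psi =1 phi].

(* The sheaf condition for a covering of Spec A by finitely many principal open
   sets Spec A_{s j}. A matching family is required to agree over every algebra
   receiving both A_{s i} and A_{s j}, equivalently over A_{s i * s j}. *)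
Definition zariski_sheaf X :=
  forall (A : comAlgType k) (m : nat) (s : 'I_m -> A)
    (B : 'I_m -> comAlgType k) (phi : forall j, {lrmorphism A -> B j})
    (y : forall j, X (B j)),
    ideal_gen (range s) 1 ->
    (forall j, is_localization [set s j ^+ e | e in setT] (phi j)) ->
    (forall i j (C : comAlgType k) (f : {lrmorphism B i -> C})
        (g : {lrmorphism B j -> C}),
      (forall a, f (phi i a) = g (phi j a)) -> fmap f (y i) = fmap g (y j)) ->
    exists! x : X A, forall j, fmap (phi j) x = y j.

Definition is_scheme X :=
  zariski_sheaf X /\
  forall (K : comAlgType k) (x : X K), is_field K ->
    exists V (A : comAlgType k) (u : X A), affine_open V u /\ V K x.

Definition scheme_of_finite_type X :=
  zariski_sheaf X /\
  exists (m : nat) (V : 'I_m -> subset_of X) (A : 'I_m -> comAlgType k)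
    (u : forall j, X (A j)),
    (forall j, affine_open (V j) (u j) /\ finitely_generated_algebra (A j)) /\
    (forall (K : comAlgType k) (x : X K), is_field K -> exists j, V j K x).

Definition reduced X :=
  forall V (A : comAlgType k) (u : X A), affine_open V u -> is_reduced_ring A.

Definition variety X := scheme_of_finite_type X /\ reduced X.

(* The diagonal X -> X x_Y X is a closed immersion: the locus in Spec A where
   two points of X(A) over the same point of Y(A) agree is defined by an ideal. *)
Definition separated X Y (f : kmorphism X Y) :=
  forall (A : comAlgType k) (x x' : X A), on_pts f x = on_pts f x' ->
    exists2 I : set A, is_ideal I &
      forall (B : comAlgType k) (phi : {lrmorphism A -> B}),
        fmap phi x = fmap phi x' <-> (forall a, I a -> phi a = 0).

(* Points of the space underlying [X] are represented by points [x : X K] over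
   fields, and closed sets by their open complements: the image of the
   complement of each open [U] is the complement of an open [V]. *)
Definition closed_morphism X Y (f : kmorphism X Y) :=
  forall U : subset_of X, open_sub U ->
    exists2 V : subset_of Y, open_sub V &
      forall (K : comAlgType k) (y : Y K), is_field K ->
        (V K y <-> ~ exists (L : comAlgType k) (j : {lrmorphism K -> L}) (x : X L),
          [/\ is_field L, ~ U L x & on_pts f x = fmap j y]).

Definition universally_closed X Y (f : kmorphism X Y) :=
  forall Z (g : kmorphism Z Y), is_scheme Z -> closed_morphism (fprod_snd f g).

(* For morphisms between schemes of finite type over [k], where being of finite
   type is automatic. *)
Definition proper_morphism X Y (f : kmorphism X Y) :=
  [/\ scheme_of_finite_type X, scheme_of_finite_type Y,
      separated f & universally_closed f].

Definition dense_sub X (U : subset_of X) :=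
  forall W : subset_of X, open_sub W ->
    (exists (K : comAlgType k) (x : X K), is_field K /\ W K x) ->
    (exists (K : comAlgType k) (x : X K), [/\ is_field K, W K x & U K x]).

(* [f] restricts to an isomorphism from [U] onto [V]. *)
Definition iso_on X Y (f : kmorphism X Y) (U : subset_of X) (V : subset_of Y) :=
  forall A : comAlgType k,
    (forall x : X A, U A x -> V A (on_pts f x)) /\
    (forall y : Y A, V A y -> exists! x : X A, U A x /\ on_pts f x = y).

Definition birational X Y (f : kmorphism X Y) :=
  exists (U : subset_of X) (V : subset_of Y),
    [/\ open_sub U, dense_sub U, open_sub V, dense_sub V & iso_on f U V].

(* The infinitesimal lifting property over [k] of the open subscheme [U]; for
   schemes locally of finite type over [k] this is smoothness. *)
Definition smooth_on X (U : subset_of X) :=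
  forall (A B : comAlgType k) (phi : {lrmorphism A -> B}),
    (forall b, exists a, phi a = b) ->
    (forall a a', phi a = 0 -> phi a' = 0 -> a * a' = 0) ->
    forall y, U B y -> exists2 x, U A x & fmap phi x = y.

Definition smooth_locus X (U : subset_of X) :=
  [/\ open_sub U, smooth_on U &
    forall U', open_sub U' -> smooth_on U' -> forall A, U' A `<=` U A].

(* In the chart (A, u), the radical ideal of the closed complement of [W]. *)
Definition vanishing_ideal X (W : subset_of X) (A : comAlgType k) (u : X A) : set A :=
  [set a | forall (K : comAlgType k) (phi : {lrmorphism A -> K}), is_field K ->
     ~ W K (fmap phi u) -> phi a = 0].

(* The complement D of the open [W], with its reduced structure, is a strict
   normal crossings divisor: at each point P of D, the local ring B is regular
   with a regular system of parameters x_0, ..., x_{d-1} such that D is cut out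
   by the product of the first r of them, for some 1 <= r <= d. *)
Definition complement_snc_divisor X (W : subset_of X) :=
  forall V (A : comAlgType k) (u : X A) (P : set A),
    affine_open V u -> is_prime_ideal P -> vanishing_ideal W u `<=` P ->
    exists (B : comAlgType k) (psi : {lrmorphism A -> B}),
      is_localization (~` P) psi /\
      exists (d r : nat) (x : 'I_d -> B),
        [/\ krull_dim B d,
            [set b | ~ invertible b] = ideal_gen (range x),
            (0 < r <= d)%N
          & ideal_gen (psi @` vanishing_ideal W u) =
            ideal_gen [set \prod_(j < d | (j < r)%N) x j]].

Definition strong_resolution X X' (phi : kmorphism X' X) :=
  [/\ variety X', proper_morphism phi, birational phi, smooth_on (@full X') &
    exists2 Xsm : subset_of X, smooth_locus Xsm &
      iso_on phi (preimage_of phi Xsm) Xsm /\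
      complement_snc_divisor (preimage_of phi Xsm)].

Definition admits_strong_resolution X :=
  exists (X' : kfunctor k) (phi : kmorphism X' X), strong_resolution phi.

End Schemes.

(* A monic polynomial of degree n is identified with the vector of its
   coefficients of degrees 0, ..., n-1. *)
Definition chevalley (A : comNzRingType) n (M : 'M[A]_n) : 'rV[A]_n :=
  \row_(j < n) (char_poly M)`_j.

Definition affine_mx (k : fieldType) (m n : nat) : kfunctor k.
Proof.
apply: (@KFunctor k (fun A => 'M[A]_(m, n))
  (fun A B (f : {lrmorphism A -> B}) => map_mx f)).
- by move=> A M; apply/matrixP => i j; rewrite mxE.
- by move=> A B C f g M; apply/matrixP => i j; rewrite !mxE.
Defined.

Definition chevalley_morphism (k : fieldType) (n : nat) :
  kmorphism (affine_mx k n n) (affine_mx k 1 n).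
Proof.
apply: (@KMorphism k (affine_mx k n n) (affine_mx k 1 n)
  (fun A => @chevalley A n)).
by move=> A B f M; apply/rowP => j; rewrite !mxE -map_char_poly coef_map.
Defined.

Record fps (k : Type) := Fps { fps_coef : nat -> k }.

Section FpsRing.
Variable k : fieldType.
Implicit Types f g h : fps k.

HB.instance Definition _ := gen_eqMixin (fps k).
HB.instance Definition _ := gen_choiceMixin (fps k).

Lemma fpsP f g : (forall n, fps_coef f n = fps_coef g n) -> f = g.
Proof. by case: f g => f [g] /= fg; congr Fps; apply/funext. Qed.

Definition fps_add f g := Fps (fun n => fps_coef f n + fps_coef g n).
Definition fps_opp f := Fps (fun n => - fps_coef f n).
Definition fps_mul f g :=
  Fps (fun n => \sum_(i < n.+1) fps_coef f i * fps_coef g (n - i)%N).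

Fact fps_addA : associative fps_add.
Proof. by move=> f g h; apply: fpsP => n /=; rewrite addrA. Qed.
Fact fps_addC : commutative fps_add.
Proof. by move=> f g; apply: fpsP => n /=; rewrite addrC. Qed.
Fact fps_add0 : left_id (Fps (fun=> 0)) fps_add.
Proof. by move=> f; apply: fpsP => n /=; rewrite add0r. Qed.
Fact fps_addN : left_inverse (Fps (fun=> 0)) fps_opp fps_add.
Proof. by move=> f; apply: fpsP => n /=; rewrite addNr. Qed.

HB.instance Definition _ :=
  GRing.isZmodule.Build (fps k) fps_addA fps_addC fps_add0 fps_addN.

Definition fps_trunc N f : {poly k} := \poly_(i < N) fps_coef f i.

Lemma fps_mul_trunc N f g n : (n < N)%N ->
  fps_coef (fps_mul f g) n = (fps_trunc N f * fps_trunc N g)`_n.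
Proof.
move=> nN; rewrite coefM; apply: eq_bigr => i _; rewrite !coef_poly.
by rewrite (leq_ltn_trans (leq_ord i) nN) (leq_ltn_trans (leq_subr _ _) nN).
Qed.

Fact fps_mulC : commutative fps_mul.
Proof.
by move=> f g; apply: fpsP => n; rewrite !(fps_mul_trunc _ _ (ltnSn n)) mulrC.
Qed.

Fact fps_mulA : associative fps_mul.
Proof.
move=> f g h; apply: fpsP => n.
transitivity ((fps_trunc n.+1 f * (fps_trunc n.+1 g * fps_trunc n.+1 h))`_n).
  rewrite coefM; apply: eq_bigr => i _ /=; rewrite coef_poly ltn_ord; congr (_ * _).
  by rewrite -(@fps_mul_trunc n.+1) // ltnS leq_subr.
rewrite mulrA coefM; apply: eq_bigr => i _ /=; rewrite [X in _ * X]coef_poly.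
rewrite ltnS leq_subr; congr (_ * _).
by rewrite -(@fps_mul_trunc n.+1) // ltn_ord.
Qed.

Fact fps_mul1 : left_id (Fps (fun n => (n == 0%N)%:R)) fps_mul.
Proof.
move=> f; apply: fpsP => n /=; rewrite big_ord_recl /= mul1r subn0 big1 ?addr0 //.
by move=> i _; rewrite mul0r.
Qed.

Fact fps_mulDl : left_distributive fps_mul fps_add.
Proof.
move=> f g h; apply: fpsP => n /=; rewrite -big_split /=.
by apply: eq_bigr => i _; rewrite mulrDl.
Qed.

Fact fps_1_neq0 : Fps (fun n => (n == 0%N)%:R : k) != 0.
Proof.
apply/eqP => /(congr1 (fun f => fps_coef f 0%N)) /= /eqP.
by rewrite oner_eq0.
Qed.

HB.instance Definition _ := GRing.Zmodule_isComNzRing.Build (fps k)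
  fps_mulA fps_mulC fps_mul1 fps_mulDl fps_1_neq0.

Definition fps_unit : {pred fps k} := fun f => `[< exists g, g * f = 1 >].
Definition fps_inv f := if f \in fps_unit then xget f [set g | g * f = 1] else f.

Fact fps_mulV : {in fps_unit, left_inverse 1 fps_inv *%R}.
Proof.
move=> f fU; rewrite /fps_inv fU; have /asboolP[g gf] := fU.
by case: xgetP => [h _ //| /(_ g)/(_ gf)].
Qed.
Fact fps_unitP f g : g * f = 1 -> f \in fps_unit.
Proof. by move=> gf; apply/asboolP; exists g. Qed.
Fact fps_inv_out : {in [predC fps_unit], fps_inv =1 id}.
Proof. by move=> f; rewrite inE /= /fps_inv => /negbTE ->. Qed.

HB.instance Definition _ := GRing.ComNzRing_hasMulInverse.Build (fps k)
  fps_mulV fps_unitP fps_inv_out.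

Lemma fps_neq0P f : f != 0 ->
  exists2 n, fps_coef f n != 0 & forall m, (m < n)%N -> fps_coef f m = 0.
Proof.
move=> f0; have ex : exists n, fps_coef f n != 0.
  apply: contrapT => nex; case/eqP: f0; apply: fpsP => n.
  by apply: contrapT => /eqP fn; apply: nex; exists n.
case: (ex_minnP ex) => n fn le; exists n => // m mn; apply/eqP/negPn/negP => fm.
by have := le _ fm; rewrite leqNgt mn.
Qed.

Fact fps_mulf_eq0 f g : f * g = 0 -> (f == 0) || (g == 0).
Proof.
move=> fg0; apply/negPn/negP; rewrite negb_or => /andP[/fps_neq0P[a fa la] /fps_neq0P[b gb lb]].
have := congr1 (fun h => fps_coef h (a + b)%N) fg0; rewrite /= => /eqP.
have aP : (a < (a + b).+1)%N by rewrite ltnS leq_addr.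
rewrite (bigD1 (Ordinal aP)) //= addKn big1 ?addr0; first by rewrite mulf_eq0 (negbTE fa) (negbTE gb).
move=> i ia; have {}ia : (i : nat) != a by apply: contraNneq ia => ia; apply/eqP/val_inj.
have [ltia | ] := ltnP i a; first by rewrite la // mul0r.
rewrite leq_eqVlt eq_sym (negbTE ia) /= => ltai.
rewrite lb ?mulr0 // ltn_subLR ?ltn_add2r //.
by rewrite -ltnS ltn_ord.
Qed.

HB.instance Definition _ := GRing.ComUnitRing_isIntegral.Build (fps k) fps_mulf_eq0.

Definition fps_t : fps k := Fps (fun n => (n == 1%N)%:R).

End FpsRing.

(* k((t)) is the fraction field of k[[t]]. *)
Definition laurent (k : fieldType) : Type := {fraction fps k}.

Section LaurentTopology.
Variable k : fieldType.

HB.instance Definition _ := GRing.Field.on (laurent k).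
HB.instance Definition _ := isPointed.Build (laurent k) 0.

(* The t-adic topology: the balls x + t^N k[[t]] form a basis. *)
Definition laurent_open : set (set (laurent k)) := [set U |
  forall x, U x -> exists N : nat, forall h : fps k, U (x + tofrac (fps_t k ^+ N * h))].

Fact laurent_openT : laurent_open setT.
Proof. by move=> x _; exists 0%N. Qed.

Fact laurent_openI : setI_closed laurent_open.
Proof.
move=> U V oU oV x [/oU[N UN] /oV[M VM]]; exists (N + M)%N => h; split.
  by rewrite exprD -mulrA; apply: UN.
by rewrite addnC exprD -mulrA; apply: VM.
Qed.

Fact laurent_open_bigU (I : Type) (f : I -> set (laurent k)) :
  (forall i, laurent_open (f i)) -> laurent_open (\bigcup_i f i).
Proof.
by move=> of_ x [i _ /of_[N fN]]; exists N => h; exists i => //; apply: fN.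
Qed.

HB.instance Definition _ := isOpenTopological.Build (laurent k)
  laurent_openT laurent_openI laurent_open_bigU.

End LaurentTopology.

Definition borel (T : ptopologicalType) := g_sigma_algebraType (@open T).

Section Measures.
Context (R : realType).

(* "mu = f nu". Complex measures are represented by their values on measurable sets. *)
Definition has_density (d : measure_display) (T : measurableType d)
    (mu : set T -> R[i]) (f : T -> R[i]) (nu : {measure set T -> \bar R}) :=
  let re x := complex.Re (f x) in
  let im x := complex.Im (f x) in
  [/\ nu.-integrable setT (EFin \o re), nu.-integrable setT (EFin \o im) &
    forall A, measurable A ->
      mu A = (\int[nu]_(x in A) re x) +i* (\int[nu]_(x in A) im x)].

Definition cmeasurable (d : measure_display) (T : measurableType d)
    (f : T -> R[i]) :=
  measurable_fun setT (fun x => complex.Re (f x)) /\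
  measurable_fun setT (fun x => complex.Im (f x)).

Definition cLspace (d : measure_display) (T : measurableType d)
    (nu : {measure set T -> \bar R}) (r : R) (f : T -> R[i]) :=
  cmeasurable f /\ finite_norm nu r%:E (fun x => ComplexField.Normc.normc (f x)).

Context (k : fieldType) (m n : nat).
Local Notation V := 'M[laurent k]_(m, n).

(* Regularity is automatic when [k] is finite, as [V] is then locally compact
   and second countable. *)
Definition haar_measure (mu : {measure set (borel V) -> \bar R}) :=
  [/\ forall (v : V) (A : set V), measurable (A : set (borel V)) ->
        mu [set v + x | x in A] = mu A,
      forall K : set V, compact K -> (mu K < +oo)%E
    & mu setT <> 0%E].

Definition smooth_compactly_supported (mu : set (borel V) -> R[i]) :=
  exists (phi : V -> R[i]) (nu : {measure set (borel V) -> \bar R}),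
    [/\ forall x : V, \forall y \near x, phi y = phi x,
        compact (closure [set x : V | phi x <> 0]),
        haar_measure nu
      & has_density mu phi nu].

End Measures.

(* Main.v *)
From HB Require Import structures.
Require Import Defs.
From mathcomp Require Import all_boot all_order all_algebra.
From mathcomp Require Import generic_quotient perm fraction zify.

(* The density is bounded and vanishes outside a compact set, hence lies in
   every L^r. Haar measures being translation invariant, its boundedness is a
   uniform count: over k[t]/(t^N), with q = #k, a monic polynomial c of degree n
   is the characteristic polynomial of at most C q^(N(n^2 - n)) matrices, where
   C does not depend on N and c.

   Conjugating one row at a time, from the bottom, brings a matrix to Hessenberg
   form with subdiagonal entries t^(b_i), which holds for a proportion at most
   q^(- sum i b_i) of the matrices. In a Hessenberg matrix H the characteristic
   polynomial depends on the last column u through the sum of the terms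
   u_j t^(b_(j+1) + ... + b_(n-1)) p_j, where p_j is monic of degree j, so the
   first n-1 columns leave at most q^(sum i b_i) choices for the last one.
   These powers of q cancel, and the sum over b converges because of the
   constraints on the other columns: modulo t^(b_i) the matrix H is block
   triangular, so by Cayley-Hamilton c annihilates its leading block of size i
   modulo t^(b_i). Hence the last diagonal entry of this block is a root modulo
   t^(b_i) of a monic polynomial of degree n determined by the other entries,
   and at most a proportion n q^(- b_i / n) of the elements are such roots. *)

Set Implicit Arguments.
Unset Strict Implicit.
Unset Printing Implicit Defensive.

Import Order.TTheory GRing.Theory.

Local Open Scope ring_scope.

(** * Counting matrices with a given characteristic polynomial *)

Section ChainRing.
Variables (R : finComNzRingType) (t : R) (N q : nat).

Definition tdiv e (x : R) := [exists y, x == t ^+ e * y].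

(** These are the finite local rings whose maximal ideal is generated by [t], of nilpotency index
    [N], with a residue field of [q] elements; the model is k[t]/(t^N). *)
Record chain_ring := ChainRing {
  chain_gt1 : (1 < q)%N;
  chain_nilp : t ^+ N = 0;
  chain_neq0 : forall m, (m < N)%N -> t ^+ m != 0;
  chain_fact : forall x, exists b u v, [/\ (b <= N)%N, x = t ^+ b * u & u * v = 1];
  chain_card : forall e, (e <= N)%N -> #|[pred x | tdiv e x]| = (q ^ (N - e))%N }.

Hypothesis cR : chain_ring.

Lemma tdivP e x : reflect (exists y, x = t ^+ e * y) (tdiv e x).
Proof. by apply: (iffP existsP) => -[y xy]; exists y; apply/eqP. Qed.

Lemma tdivD e x y : tdiv e x -> tdiv e y -> tdiv e (x + y).
Proof.
by move=> /tdivP[a ->] /tdivP[b ->]; apply/tdivP; exists (a + b); rewrite mulrDr.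
Qed.

Lemma tdivMr e x y : tdiv e x -> tdiv e (y * x).
Proof. by move=> /tdivP[a ->]; apply/tdivP; exists (y * a); rewrite mulrCA. Qed.

Lemma tdiv0 e : tdiv e 0.
Proof. by apply/tdivP; exists 0; rewrite mulr0. Qed.

Lemma tdivB e x y : tdiv e x -> tdiv e y -> tdiv e (x - y).
Proof. by move=> tx ty; rewrite -mulN1r; apply/tdivD/tdivMr. Qed.

Lemma tdiv_sum e (I : finType) (P : pred I) (F : I -> R) :
  (forall i, P i -> tdiv e (F i)) -> tdiv e (\sum_(i | P i) F i).
Proof. by move=> tF; elim/big_ind: _ => //; [exact: tdiv0|exact: tdivD]. Qed.

Lemma tdiv_le d e x : (d <= e)%N -> tdiv e x -> tdiv d x.
Proof.
move=> de /tdivP[y ->]; apply/tdivP; exists (t ^+ (e - d) * y).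
by rewrite mulrA -exprD subnKC.
Qed.

(** For x = t^c u with u a unit, t^(b + c) = 0 forces N <= b + c. *)
Lemma tdiv_ann b x : (b <= N)%N -> t ^+ b * x = 0 -> tdiv (N - b) x.
Proof.
move=> bN bx0; have [c [u [v [cN xE uv]]]] := chain_fact cR x.
have tbc0 : t ^+ (b + c) = 0.
  by rewrite -[LHS]mulr1 -uv mulrA exprD -(mulrA (t ^+ b)) -xE bx0 mul0r.
have Nbc : (N <= b + c)%N.
  by rewrite leqNgt; apply/negP => /(chain_neq0 cR); rewrite tbc0 eqxx.
apply: (@tdiv_le _ c); first by rewrite leq_subLR.
by apply/tdivP; exists u.
Qed.

(** Cancelling t^b determines the quotient only modulo t^(N - b); as e <= N, this is at least as
    fine as modulo t^(e - b). *)
Lemma tdiv_cancel b e x : (b <= e <= N)%N -> tdiv e (t ^+ b * x) -> tdiv (e - b) x.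
Proof.
move=> /andP[be eN] /tdivP[y xy].
have : tdiv (N - b) (x - t ^+ (e - b) * y).
  apply: tdiv_ann; first exact: leq_trans be eN.
  by rewrite mulrBr mulrA -exprD subnKC // xy subrr.
move=> /(tdiv_le (leq_sub2r b eN)) td.
rewrite -[x](subrK (t ^+ (e - b) * y)); apply: tdivD => //.
by apply/tdivP; exists y.
Qed.

Lemma tdiv_1 e : (0 < e)%N -> ~~ tdiv e 1.
Proof.
move=> e0; apply/negP => /tdivP[y e1].
have : (1 : R) ^+ N == 0.
  rewrite e1 exprMn exprAC (chain_nilp cR) expr0n.
  by case: e e0 {e1} => // e _; rewrite mul0r.
by rewrite expr1n oner_eq0.
Qed.

(** Induction on the degree: if u0 is one root modulo t^e and p = p1 (X - u0) + p(u0), then t^e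
    divides (u - u0) p1(u) for any other root u. Either t^a divides u - u0, or the valuation of u -
    u0 is at most a - 1 and u is a root of p1 modulo t^(e - (a - 1)). The hypothesis D (a - 1) < e
    allows D such steps. *)
Lemma root_cover D (p : {poly R}) e a : p \is monic -> size p = D.+1 ->
  (D * a.-1 < e <= N)%N ->
  exists2 s : seq R, (size s <= D)%N &
    forall u, tdiv e p.[u] -> has (fun v => tdiv a (u - v)) s.
Proof.
elim: D p e => [|D IH] p e pm sp /andP[De eN].
  exists [::] => // u; rewrite mul0n in De.
  have /size_poly1P[c c0 pE] : size p == 1%N by rewrite sp.
  move: pm; rewrite pE monicE lead_coefC hornerC => /eqP ->.
  by rewrite (negbTE (tdiv_1 De)).
have [/existsP[u0 u0P]|/existsPn noroot] := boolP [exists u, tdiv e p.[u]]; last first.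
  by exists [::] => // u; rewrite (negbTE (noroot u)).
have /factor_theorem[p1 p1E] : root (p - p.[u0]%:P) u0.
  by rewrite /root !hornerE subrr.
have pE : p = p1 * ('X - u0%:P) + p.[u0]%:P by rewrite -p1E subrK.
have sC : (size (p.[u0]%:P) < size p)%N.
  by rewrite sp; apply: leq_ltn_trans (size_polyC_leq1 _) _.
have sM : size (p1 * ('X - u0%:P)) = D.+2.
  by rewrite -p1E size_polyDl // size_polyN.
have p1m : p1 \is monic.
  by rewrite monicE -(lead_coef_Mmonic _ (monicXsubC u0)) -p1E lead_coefDl ?size_polyN.
have sp1 : size p1 = D.+1.
  have := sM; rewrite size_Mmonic ?monicXsubC ?monic_neq0 // size_XsubC addn2 /=.
  by case.
rewrite mulSn in De.
have aD : (D * a.-1 < e - a.-1 <= N)%N by lia.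
have [s ss sP] := IH p1 _ p1m sp1 aD.
exists (u0 :: s) => //= u; rewrite pE !hornerE => pu.
have {}pu : tdiv e ((u - u0) * p1.[u]).
  rewrite [X in tdiv e X](_ : _ = p1.[u] * (u - u0) + p.[u0] - p.[u0]); last first.
    by rewrite addrK mulrC.
  exact: tdivB.
have [b [v [w [bN uE vw]]]] := chain_fact cR (u - u0).
have [ab|ba] := leqP a b.
  apply/orP; left; rewrite uE; apply: (tdiv_le ab).
  by apply/tdivP; exists v.
apply/orP; right; apply: sP.
have be : (b <= e <= N)%N.
  by rewrite eN andbT; have := leq_addr (D * a.-1) a.-1; lia.
have : tdiv (e - b) (w * (v * p1.[u])).
  by apply: tdivMr; apply: tdiv_cancel => //; rewrite mulrA -uE.
rewrite mulrA (mulrC w) vw mul1r; apply: tdiv_le; lia.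
Qed.

Lemma card_tdiv_shift e v : (e <= N)%N ->
  #|[pred u | tdiv e (u - v)]| = (q ^ (N - e))%N.
Proof.
move=> eN; rewrite -(chain_card cR eN).
rewrite -(card_image (addIr (- v))); apply: eq_card => x.
rewrite !inE; apply/imageP/idP => [[u uv ->] //|tx].
by exists (x + v); rewrite ?inE addrK.
Qed.

Lemma chain_cardR : #|R| = (q ^ N)%N.
Proof.
rewrite -[N in RHS]subn0 -(chain_card cR (leq0n N)); apply: eq_card => x.
by rewrite !inE; apply/esym/tdivP; exists x; rewrite mul1r.
Qed.

(** The ceiling of b / d, for d > 0. *)
Definition cdiv d b := ((b + d.-1) %/ d)%N.

(** The value a = [cdiv d e] is the largest with d (a - 1) < e, so [root_cover] places the roots in
    at most d balls of q^(N - a) elements each. *)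
Lemma card_roots d (p : {poly R}) e : p \is monic -> size p = d.+1 ->
  (0 < d)%N -> (e <= N)%N ->
  (#|[pred u | tdiv e p.[u]]| <= d * q ^ (N - cdiv d e))%N.
Proof.
move=> pm sp d0 eN.
(* For e = 0 the strict inequality asked by [root_cover] fails, and the size of the whole ring is
   the bound. *)
have [->|e0] := posnP e.
  rewrite /cdiv add0n divn_small ?prednK // subn0 -chain_cardR.
  apply: leq_trans (max_card _) _; exact: leq_pmull.
have dE := divn_eq (e + d.-1) d; have := ltn_pmod (e + d.-1) d0.
rewrite -/(cdiv d e) in dE; move=> mlt.
have a0 : (0 < cdiv d e)%N by rewrite /cdiv divn_gt0 //; lia.
have ae : (cdiv d e <= e)%N by nia.
have [|s ss sP] := @root_cover d p e (cdiv d e) pm sp.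
  rewrite eN andbT; case: (cdiv d e) a0 dE ae => // a _ /=; nia.
apply: (@leq_trans (\sum_(v <- s) #|[pred u | tdiv (cdiv d e) (u - v)%R]|)%N);
  last first.
  rewrite (eq_bigr (fun=> (q ^ (N - cdiv d e))%N)) => [|v _].
    by rewrite big_const_seq iter_addn_0 count_predT mulnC leq_mul2r ss orbT.
  by rewrite card_tdiv_shift // (leq_trans ae).
rewrite -sum1_card.
under [X in (_ <= X)%N]eq_bigr => v _ do rewrite -sum1_card big_mkcond.
rewrite exchange_big /= big_mkcond; apply: leq_sum => u _; rewrite inE.
case: ifP => // /sP/hasP[v vs uv].
by rewrite (big_rem v) //= inE uv.
Qed.

Lemma card_ann s : (#|[pred x | (t ^+ s * x == 0)%R]| <= q ^ s)%N.
Proof.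
have [sN|Ns] := leqP s N; last first.
  apply: leq_trans (max_card _) _; rewrite chain_cardR.
  by rewrite leq_pexp2l ?(ltnW (chain_gt1 cR)) // ltnW.
rewrite -{2}(subKn sN) -(chain_card cR (leq_subr _ _)).
by apply/subset_leq_card/subsetP => x; rewrite !inE => /eqP; apply: tdiv_ann.
Qed.

End ChainRing.

(** * Polynomials in a matrix as functions of one diagonal entry *)

Section MonicEntry.
Variables (R : comNzRingType) (n : nat).

(** Let B = A + X E_jj over the polynomial ring. From B^(i+1) = A B^i + X E_jj B^i, column j of B^i
    has degrees at most i and its entry (j, j) is monic of degree i. Combining these diagonal
    entries with the coefficients of [c] gives a monic polynomial of the degree of [c]. *)
Lemma monic_diag_entry (A : 'M[R]_n.+1) (j : 'I_n.+1) (c : {poly R}) : c \is monic ->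
  exists f : {poly R}, [/\ f \is monic, size f = size c &
    forall u, f.[u] = horner_mx (A + u *: delta_mx j j) c j j].
Proof.
move=> cm; pose B : 'M[{poly R}]_n.+1 := map_mx polyC A + 'X *: delta_mx j j.
have Bu u : map_mx (horner_eval u) B = A + u *: delta_mx j j.
  rewrite map_mxD map_mxZ map_delta_mx /= -map_mx_comp /horner_eval /= hornerX.
  by congr (_ + _); apply/matrixP => a b; rewrite !mxE /= hornerC.
have Bk u i : ((B ^+ i) j j).[u] = ((A + u *: delta_mx j j) ^+ i) j j.
  by rewrite -Bu -rmorphXn /= mxE.
have sB i : (forall a, size ((B ^+ i) a j) <= i.+1)%N /\
    (((B ^+ i) j j) \is monic /\ size ((B ^+ i) j j) = i.+1).
  elim: i => [|i [IHs [IHm IHe]]].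
    split=> [a|]; last by rewrite mxE eqxx monic1 size_poly1.
    by rewrite mxE; case: (a == j); rewrite ?size_poly1 ?size_poly0.
  have lo a : (size (\sum_l (A a l)%:P * (B ^+ i) l j)%R <= i.+1)%N.
    apply: leq_trans (size_sum _ _ _) _; apply/bigmax_leqP => l _.
    by rewrite mul_polyC; apply: leq_trans (size_scale_leq _ _) _.
  have BE a : (B ^+ i.+1) a j = \sum_l (A a l)%:P * (B ^+ i) l j +
      'X * (B ^+ i) j j *+ (a == j).
    rewrite exprS mxE -[RHS]/(_ + _); under eq_bigr => l _ do rewrite !mxE mulrDl.
    rewrite big_split /=; congr (_ + _).
    rewrite (bigD1 j) //= eqxx andbT big1 ?addr0 => [|l lj].
      by case: (a == j); rewrite ?mulr1 ?mulr0 ?mul0r.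
    by rewrite (negbTE lj) andbF mulr0 mul0r.
  have sX : size ('X * (B ^+ i) j j) = i.+2.
    by rewrite mulrC size_mulX ?IHe // monic_neq0.
  split=> [a|].
    rewrite BE; apply: leq_trans (size_polyD _ _) _; rewrite geq_max.
    rewrite (leq_trans (lo a)) //=; case: (a == j); rewrite ?mulr1n ?mulr0n ?size_poly0 //.
    by rewrite sX.
  rewrite BE eqxx mulr1n addrC.
  have lt : (size (\sum_l (A j l)%:P * (B ^+ i) l j)%R < size ('X * (B ^+ i) j j)%R)%N.
    by rewrite sX ltnS.
  rewrite size_polyDl // sX; split=> //.
  by rewrite monicE lead_coefDl // mulrC lead_coefMX -monicE.
have sc : size c = (size c).-1.+1.
  by rewrite prednK // size_poly_gt0 monic_neq0.
exists (\sum_(i < size c) c`_i *: (B ^+ i) j j).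
have lo : (size (\sum_(i < (size c).-1) c`_i *: (B ^+ i) j j)%R <
    size ((B ^+ (size c).-1)%R j j))%N.
  rewrite (proj2 (proj2 (sB _))); apply: leq_ltn_trans (size_sum _ _ _) _.
  rewrite ltnS; apply/bigmax_leqP => i _.
  by apply: leq_trans (size_scale_leq _ _) _; apply: leq_trans (proj1 (sB i) j) _.
split.
- rewrite sc big_ord_recr /=; move: cm; rewrite monicE lead_coefE => /eqP ->.
  rewrite scale1r addrC monicE lead_coefDl // -monicE.
  by have [_ []] := sB (size c).-1.
- rewrite [in LHS]sc big_ord_recr /=; move: cm; rewrite monicE lead_coefE => /eqP ->.
  by rewrite scale1r addrC size_polyDl // (proj2 (proj2 (sB _))) -sc.
move=> u; rewrite horner_sum.
rewrite (_ : horner_mx _ c = \sum_(i < size c) c`_i *: (A + u *: delta_mx j j) ^+ i).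
  by rewrite summxE; apply: eq_bigr => i _; rewrite hornerZ Bk mxE.
rewrite -[in LHS](coefK c) poly_def rmorph_sum /=; apply: eq_bigr => i _.
by rewrite linearZ /= rmorphXn /= horner_mx_X.
Qed.

End MonicEntry.

(** * Characteristic polynomials of Hessenberg matrices *)

Section Hessenberg.
Variables (R : comNzRingType) (t : R).
Implicit Types (b : nat -> nat) (H : nat -> nat -> R).

(** The coefficient of degree m sees only the last term, so c m = 0; then descend. *)
Lemma triangular_monic_eq0 m (p : nat -> {poly R}) (c : nat -> R) :
  (forall i, (i <= m)%N -> p i \is monic /\ size (p i) = i.+1) ->
  \sum_(i < m.+1) (c i)%:P * p i = 0 -> forall i, (i <= m)%N -> c i = 0.
Proof.
elim: m => [|m IH] pm s0 i im.
  move: s0; rewrite big_ord1; have [pm0 sp0] := pm 0%N isT.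
  move: im; rewrite leqn0 => /eqP ->.
  move=> /(congr1 (fun q : {poly R} => q`_0)); rewrite coefCM coef0.
  by move: (monicP pm0); rewrite lead_coefE sp0 => ->; rewrite mulr1.
have cm0 : c m.+1 = 0.
  move: s0; rewrite big_ord_recr /= => /(congr1 (fun q : {poly R} => q`_m.+1)).
  rewrite coefD coefCM coef0 coef_sum big1 => [|l _].
    have [/monicP pm1 sp1] := pm m.+1 (leqnn _).
    by rewrite add0r; move: pm1; rewrite lead_coefE sp1 /= => ->; rewrite mulr1.
  rewrite coefCM nth_default ?mulr0 //.
  by have [_ ->] := pm l (ltnW (ltn_ord l)).
move: im; rewrite leq_eqVlt => /predU1P[-> //|im].
apply: IH im => [l lm|]; first by apply: pm; apply: leqW.
by move: s0; rewrite big_ord_recr /= cm0 mul0r addr0.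
Qed.

(** The last column of a characteristic matrix is made arbitrary, so that the determinant becomes a
    linear function of it. Indexing [H] by naturals lets the leading blocks of all sizes come from
    one object. *)
Definition hess_char_mx m H (u : nat -> {poly R}) : 'M[{poly R}]_m.+1 :=
  \matrix_(i, j) if (j < m)%N then 'X *+ (i == j) - (H i j)%:P else u i.

(** Expansion along the last row, where at most two entries are nonzero: the subdiagonal one, whose
    minor is the matrix of the same kind one size smaller with last column [u], and the corner,
    whose minor is the characteristic matrix of the leading block. Thus [p i] is the characteristic
    polynomial of the leading block of size i. *)
Lemma det_hess_char_mx m b H :
  (forall j, (j < m)%N -> H j.+1 j = t ^+ b j.+1) ->
  (forall i j, (j.+1 < i <= m)%N -> H i j = 0) ->
  exists p : nat -> {poly R},
    (forall i, (i <= m)%N -> p i \is monic /\ size (p i) = i.+1) /\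
    forall u, \det (hess_char_mx m H u) =
      \sum_(i < m.+1) u i * (t ^+ (\sum_(i.+1 <= l < m.+1) b l))%:P * p i.
Proof.
elim: m => [|m IH] Hs H0.
  exists (fun=> 1); split=> [i|u].
    by rewrite leqn0 => /eqP ->; rewrite monic1 size_poly1.
  by rewrite det_mx11 mxE ltnn big_ord1 big_geq // expr0 !mulr1.
have [||p [pm pE]] := IH.
- by move=> j jm; apply: Hs; apply: ltnW.
- by move=> i j /andP[ij im]; apply: H0; rewrite ij leqW.
pose v i : {poly R} := 'X *+ (i == m) - (H i m)%:P.
pose p' i := if i == m.+1 then \det (hess_char_mx m H v) else p i.
exists p'; split=> [i|u].
  rewrite /p' leq_eqVlt; case: eqVneq => [-> _|_ /= im]; last exact: pm.
  rewrite pE big_ord_recr /= big_geq // expr0 mulr1 /v eqxx mulr1n.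
  have [mm sm] := pm m (leqnn m).
  have sX : size (('X - (H m m)%:P) * p m) = m.+2.
    by rewrite size_monicM ?monicXsubC ?monic_neq0 // size_XsubC sm.
  have lt : (size (\sum_(i < m) ('X *+ (i == m :> nat) - (H i m)%:P) *
      (t ^+ (\sum_(i.+1 <= l < m.+1) b l))%:P * p i)%R <
      size (('X - (H m m)%:P) * p m)%R)%N.
    rewrite sX; apply: leq_ltn_trans (size_sum _ _ _) _.
    rewrite ltnS; apply/bigmax_leqP => l _.
    rewrite (ltn_eqF (ltn_ord l)) mulr0n sub0r -polyCN -polyCM mul_polyC.
    apply: leq_trans (size_scale_leq _ _) _.
    by have [_ ->] := pm l (ltnW (ltn_ord l)); rewrite ltnS ltnW.
  rewrite addrC; split; last by rewrite size_polyDl.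
  by rewrite monicE lead_coefDl // -monicE monicMr // monicXsubC.
rewrite (expand_det_row _ ord_max) big_ord_recr /= big_ord_recr /=.
rewrite big1 ?add0r => [|i _]; last first.
  rewrite mxE /= (ltn_trans (ltn_ord i)) // H0 ?ltnS ?leqnn ?andbT //.
  rewrite -val_eqE /= gtn_eqF ?subr0 ?mul0r //.
  by rewrite (ltn_trans (ltn_ord i)).
rewrite [in RHS]big_ord_recr /= big_geq // expr0 mulr1 /p' eqxx.
rewrite !mxE /= ltnn leqnn; congr (_ + _); last first.
  rewrite /cofactor /= -signr_odd oddD addbb expr0 mul1r; congr (_ * \det _).
  apply/matrixP => i j; rewrite !mxE -!val_eqE !lift_max ltn_ord /v.
  have lv (l : 'I_m.+1) : \val (lift (ord_max : 'I_m.+2) l) = l by exact: lift_max.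
  rewrite !lv; case: ltnP => // mj.
  by have -> : nat_of_ord j = m by apply/eqP; rewrite eqn_leq mj -ltnS ltn_ord.
rewrite -val_eqE /= (gtn_eqF (ltnSn m)) mulr0n sub0r Hs //.
rewrite /cofactor /= -signr_odd addSn /= oddD addbb expr1.
set M := row' _ _; have -> : M = hess_char_mx m H u :> 'M_m.+1.
  apply/matrixP => i j; rewrite !mxE -!val_eqE.
  have -> : \val (lift (ord_max : 'I_m.+2) i) = i by exact: lift_max.
  have -> : nat_of_ord (lift (ord_max : 'I_m.+2) i) = i by exact: lift_max.
  rewrite /= /bump; case: (ltnP j m) => jm; last by rewrite add1n ltnS ltnNge jm.
  by rewrite add0n ltnS ltnW.
rewrite mulN1r mulrNN (pE u) big_distrr /=; apply: eq_bigr => i _.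
rewrite (_ : (i == m.+1 :> nat) = false); last by rewrite ltn_eqF.
rewrite [in RHS]big_nat_recr /=; last by [].
by rewrite exprD polyCM mulrCA -!mulrA; congr (_ * _); rewrite mulrCA.
Qed.

(** As the matrices agree outside the last column, the same polynomials [p i] expand both
    determinants. Their difference is zero, and the [p i] are linearly independent. *)
Lemma char_poly_hess_last_column m b (H H' : 'M[R]_m.+1) :
  (forall i j : 'I_m.+1, (j < i)%N ->
     H i j = if i == j.+1 :> nat then t ^+ b i else 0) ->
  (forall i j : 'I_m.+1, (j < m)%N -> H i j = H' i j) ->
  char_poly H = char_poly H' ->
  forall i : 'I_m.+1,
    t ^+ (\sum_(i.+1 <= l < m.+1) b l) * (H i ord_max - H' i ord_max) = 0.
Proof.
move=> Hh HH' cHH'.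
pose G i j := H (inord i) (inord j).
pose G' i j := H' (inord i) (inord j).
have Gv (K : 'M[R]_m.+1) i j : K (inord (nat_of_ord i)) (inord (nat_of_ord j)) = K i j.
  by rewrite !inord_val.
have [||p [pm pE]] := @det_hess_char_mx m b G.
- by move=> j jm; rewrite /G Hh ?inordK ?eqxx ?ltnS // ltnW.
- move=> i j /andP[ji im]; rewrite /G Hh ?inordK ?(gtn_eqF ji) ?ltnS //; lia.
pose u (K : 'M[R]_m.+1) i : {poly R} := 'X *+ (i == m) - (K (inord i) ord_max)%:P.
have cE (K : 'M[R]_m.+1) : (forall i j : 'I_m.+1, (j < m)%N -> H i j = K i j) ->
    char_poly K = \det (hess_char_mx m G (u K)).
  move=> HK; rewrite /char_poly; congr (\det _); apply/matrixP => i j.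
  rewrite !mxE /G /u !inord_val; case: ltnP => jm; first by rewrite HK.
  have -> : j = ord_max by apply/val_inj/eqP; rewrite /= eqn_leq jm -ltnS ltn_ord.
  by rewrite -val_eqE.
move/eqP: cHH'; rewrite (cE H) // (cE H') // !pE -subr_eq0 -sumrB.
move=> /eqP s0 i; rewrite -opprB mulrN; apply/eqP; rewrite oppr_eq0; apply/eqP.
have := @triangular_monic_eq0 m p (fun i => t ^+ (\sum_(i.+1 <= l < m.+1) b l) *
  (H' (inord i) ord_max - H (inord i) ord_max)) pm.
move=> /(_ _ i); rewrite inord_val; apply; last by rewrite -ltnS.
rewrite -[RHS]s0; apply: eq_bigr => l _.
have uE : u H l - u H' l = (H' (inord l) ord_max - H (inord l) ord_max)%:P.
  by rewrite /u opprB addrC addrA subrK polyCB.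
by rewrite -!mulrA -mulrBl uE polyCM mulrCA mulrA.
Qed.

End Hessenberg.

Lemma card_fibers (T U : finType) (f : T -> U) (S : {set T}) B :
  (forall y, y \in f @: S -> (#|[set x in S | f x == y]| <= B)%N) ->
  (#|S| <= #|f @: S| * B)%N.
Proof.
move=> fB; rewrite -sum1_card (partition_big f [in f @: S]) /=; last first.
  by move=> x xS; exact: imset_f.
rewrite -sum_nat_const; apply: leq_sum => y yS.
by rewrite sum1dep_card; exact: fB.
Qed.

Lemma horner_mxE (R : comNzRingType) n (A : 'M[R]_n.+1) (c : {poly R}) :
  horner_mx A c = \sum_(i < size c) c`_i *: A ^+ i.
Proof.
rewrite -[in LHS](coefK c) poly_def rmorph_sum /=; apply: eq_bigr => i _.
by rewrite linearZ /= rmorphXn /= horner_mx_X.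
Qed.

(** The term b l belongs to the l tails i = 0, ..., l - 1. The left side is the exponent of q in the
    number of last columns. *)
Lemma sum_tails n (b : nat -> nat) :
  (\sum_(i < n.+1) \sum_(i.+1 <= l < n.+1) b l = \sum_(j < n) j.+1 * b j.+1)%N.
Proof.
elim: n => [|n IH]; first by rewrite big_ord1 big_ord0 big_geq.
rewrite big_ord_recr /= [X in (_ + X)%N]big_geq // addn0 [in RHS]big_ord_recr /= -IH.
under eq_bigr => i _ do rewrite big_nat_recr //=.
by rewrite big_split /= sum_nat_const card_ord.
Qed.

(** * Counting Hessenberg matrices with a given characteristic polynomial *)

Section HessenbergCount.
Variables (R : finComNzRingType) (t : R) (N q n : nat).
Hypothesis cR : chain_ring t N q.
Implicit Types (b : nat -> nat) (c : {poly R}) (x y H : 'M[R]_n.+1).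

(** The shape is imposed on the rows from r on only: there is no condition for r = n.+1, and r = 1
    gives the full Hessenberg shape, since row 0 has nothing left of the diagonal. *)
Definition hess r b x := [forall i : 'I_n.+1, forall j : 'I_n.+1,
  ((r <= i) && (j < i))%N ==> (x i j == if i == j.+1 :> nat then t ^+ b i else 0)].

Lemma hessP r b x : reflect (forall i j : 'I_n.+1, (r <= i)%N -> (j < i)%N ->
  x i j = if i == j.+1 :> nat then t ^+ b i else 0) (hess r b x).
Proof.
apply: (iffP forallP) => h i; last first.
  by apply/forallP => j; apply/implyP => /andP[ri ji]; apply/eqP/h.
by move=> j ri ji; have /forallP/(_ j)/implyP := h i; rewrite ri ji => /(_ isT)/eqP.
Qed.

Definition hess_fibre r b c := [set x | hess r b x & char_poly x == c].

Definition trunc_cols j x : 'M[R]_n.+1 :=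
  \matrix_(u, v) if (v < j)%N then x u v else 0.

(** Modulo t^e the span of the first j coordinates is stable under [x], so the powers of [x]
    restricted to it involve only the first j columns. *)
Lemma horner_trunc_cols e c x j :
  (forall u v : 'I_n.+1, (v < j <= u)%N -> tdiv t e (x u v)) ->
  forall u v : 'I_n.+1, (v < j)%N ->
    tdiv t e (horner_mx (trunc_cols j x) c u v - horner_mx x c u v).
Proof.
move=> xe; have pw k : forall u v : 'I_n.+1, (v < j)%N ->
    tdiv t e ((trunc_cols j x ^+ k) u v - (x ^+ k) u v).
  elim: k => [|k IH] u v vj; first by rewrite !expr0 subrr tdiv0.
  rewrite !exprSr !mxE -sumrB; apply: tdiv_sum => l _.
  rewrite [X in _ * X - _]mxE vj -mulrBl mulrC.
  have [lj|jl] := ltnP l j; first by apply: tdivMr; apply: IH.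
  by rewrite mulrC; apply: tdivMr; apply: xe; rewrite vj.
move=> u v vj; rewrite !horner_mxE !summxE -sumrB; apply: tdiv_sum => i _.
by rewrite !mxE -mulrBr; apply: tdivMr; apply: pw.
Qed.

(** Induction on j. Given the first j columns, the next one has j entries above the diagonal, with
    q^(N j) possible values, a diagonal entry among the roots modulo t^(b j.+1) of a monic
    polynomial of degree n.+1, and prescribed entries below. *)
Lemma card_hess_columns b c j : (forall l, (b l <= N)%N) -> (j <= n)%N ->
  (#|trunc_cols j @: hess_fibre 1 b c| <=
    \prod_(l < j) (q ^ (N * l) * (n.+1 * q ^ (N - cdiv n.+1 (b l.+1)))))%N.
Proof.
move=> bN; elim: j => [_|j IH jn].
  rewrite big_ord0 -(cards1 (0 : 'M[R]_n.+1)); apply: subset_leq_card.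
  apply/subsetP => _ /imsetP[x _ ->]; rewrite inE; apply/eqP/matrixP => u v.
  by rewrite !mxE.
rewrite big_ord_recr /=; set S := hess_fibre 1 b c; set T := _ @: S.
have trT : trunc_cols j @: T = trunc_cols j @: S.
  rewrite -imset_comp; apply: eq_imset => x /=; apply/matrixP => u v.
  by rewrite !mxE; case: ltnP => // vj; rewrite ltnS ltnW.
apply: leq_trans (card_fibers (f := trunc_cols j) _) _; last first.
  by rewrite trT; apply: leq_mul (IH (ltnW jn)) (leqnn _).
move=> y _; set X := [set _ in _ | _]; pose j' : 'I_n.+1 := Ordinal (leqW jn).
(* [er] erases the entry (j, j): the other entries are counted first, and the diagonal entry
   afterwards along the fibres of [er]. *)
pose er x : 'M[R]_n.+1 := \matrix_(u, v) if (u == j') && (v == j') then 0 else x u v.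
apply: leq_trans (card_fibers (f := er) _) _; last first.
  apply: leq_mul (leqnn _).
  pose g x := [ffun i : 'I_j => x (widen_ord (leqW (ltnW jn)) i) j'].
  rewrite -(card_in_imset (f := g)); last first.
    have XE x u v : x \in X -> er x u v = if (v < j)%N then y u v else
        if v == j' then (if (u < j)%N then er x u j' else
          if u == j' then 0 else if u == j.+1 :> nat then t ^+ b u else 0) else 0.
      rewrite !inE => /andP[/imsetP[H]]; rewrite inE => /andP[/hessP hH _] -> /eqP <-.
      rewrite !mxE; case: (ltnP v j) => vj.
        by rewrite -!val_eqE /= (ltn_eqF vj) andbF ltnS ltnW.
      case: (eqVneq v j') => [->|]; last first.
        rewrite -val_eqE /= => vj'; rewrite andbF ltnS leqNgt.
        by rewrite ltn_neqAle eq_sym vj' vj.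
      rewrite andbT eqxx andbT ltnSn; case: (ltnP u j) => uj //.
      case: eqVneq => // uj'; apply: hH; last first.
        by rewrite /= ltn_neqAle uj andbT eq_sym.
      rewrite lt0n; apply: contra uj' => /eqP u0; apply/eqP/val_inj.
      by rewrite /= u0; apply/esym/eqP; rewrite -leqn0 -u0.
    move=> _ _ /imsetP[x1 x1X ->] /imsetP[x2 x2X ->] /ffunP g12.
    apply/matrixP => u v; rewrite (XE _ u v x1X) (XE _ u v x2X).
    case: ifP => // _; case: ifP => // _.
    case: ltnP => // uj; have := g12 (Ordinal uj); rewrite !ffunE.
    by congr (er _ _ _ = er _ _ _); apply/val_inj.
  apply: leq_trans (max_card _) _; rewrite card_ffun card_ord (chain_cardR cR).
  by rewrite expnM.
move=> z _; set Z := [set _ in X | _].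
have [->|[x0 x0Z]] := set_0Vmem Z; first by rewrite cards0.
have cm : c \is monic /\ size c = n.+2.
  move: x0Z; rewrite !inE => /andP[/andP[/imsetP[H + _] _] _].
  by rewrite inE => /andP[_ /eqP <-]; rewrite char_poly_monic size_char_poly.
(* Modulo t^(b j.+1) the subspace of the first j.+1 coordinates is stable, so
   Cayley-Hamilton gives c = 0 on the leading block; f is its last diagonal
   entry, as a polynomial in the entry (j, j). *)
have [f [fm sf fE]] := monic_diag_entry z j' (proj1 cm).
rewrite (proj2 cm) in sf.
apply: leq_trans (card_roots cR fm sf _ (bN _)); last by [].
rewrite -(card_in_imset (f := fun x : 'M[R]_n.+1 => x j' j')); last first.
  move=> x1 x2; rewrite !inE => /andP[_ /eqP z1] /andP[_ /eqP z2] x12.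
  apply/matrixP => u v.
  have := congr1 (fun M : 'M[R]_n.+1 => M u v) (etrans z1 (esym z2)).
  by rewrite !mxE; case: ifP => // /andP[/eqP-> /eqP->].
apply: subset_leq_card; apply/subsetP => _ /imsetP[x + ->].
rewrite !inE => /andP[/andP[/imsetP[H HS xH] _] /eqP zE].
rewrite fE.
have -> : z + x j' j' *: delta_mx j' j' = trunc_cols j.+1 H.
  rewrite -xH -zE; apply/matrixP => u v; rewrite !mxE.
  by case: eqVneq => [->|_]; case: eqVneq => [->|_]; rewrite /= ?mulr1 ?mulr0 ?add0r ?addr0.
move: HS; rewrite inE => /andP[/hessP hH /eqP cH].
have := @horner_trunc_cols (b j.+1) c H j.+1 _ j' j' (ltnSn j).
rewrite -{2}cH Cayley_Hamilton mxE subr0; apply => u v /andP[vj ju].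
rewrite hH; last 2 first.
- exact: leq_trans ju.
- exact: leq_trans vj ju.
case: eqP => [uv|_]; last exact: tdiv0.
have -> : nat_of_ord u = j.+1 by lia.
by apply/tdivP; exists 1; rewrite mulr1.
Qed.

(** Once the other columns are fixed, two last columns with the same characteristic polynomial
    differ in row i by an element killed by t to the power b i.+1 + ... + b n; this annihilator has
    at most q to that power elements. *)
Lemma card_hess_fibre b c : (forall l, (b l <= N)%N) ->
  (#|hess_fibre 1 b c| <=
    \prod_(l < n) (q ^ (N * l) * (n.+1 * q ^ (N - cdiv n.+1 (b l.+1))) *
       q ^ (l.+1 * b l.+1)))%N.
Proof.
move=> bN; rewrite big_split /=.
apply: leq_trans (card_fibers (f := trunc_cols n) _) _; last first.
  by apply: leq_mul (card_hess_columns c bN (leqnn n)) (leqnn _).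
move=> y _; set X := [set _ in _ | _].
have [->|[x0 x0X]] := set_0Vmem X; first by rewrite cards0.
pose g (x : 'M[R]_n.+1) := [ffun i : 'I_n.+1 => x i ord_max - x0 i ord_max].
rewrite -(card_in_imset (f := g)); last first.
  move=> x1 x2; rewrite !inE => /andP[_ /eqP z1] /andP[_ /eqP z2] /ffunP x12.
  apply/matrixP => u v.
  have := congr1 (fun M : 'M[R]_n.+1 => M u v) (etrans z1 (esym z2)).
  rewrite !mxE; case: ltnP => // nv _.
  have -> : v = ord_max by apply/val_inj/eqP; rewrite /= eqn_leq nv -ltnS ltn_ord.
  by have := x12 u; rewrite !ffunE => /addIr.
pose F (i : 'I_n.+1) := [pred z | t ^+ (\sum_(i.+1 <= l < n.+1) b l) * z == 0].
apply: (@leq_trans #|(family F : {pred {ffun 'I_n.+1 -> R}})|).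
  apply/subset_leq_card/subsetP => _ /imsetP[x xX ->]; apply/familyP => i.
  rewrite inE ffunE; apply/eqP.
  move: xX x0X; rewrite !inE => /andP[/andP[/hessP xh /eqP xc] /eqP xy].
  move=> /andP[/andP[_ /eqP x0c] /eqP x0y].
  apply: char_poly_hess_last_column; last by rewrite xc.
    by move=> u v uv; apply: xh => //; apply: leq_ltn_trans uv.
  move=> u v vn; have := congr1 (fun M : 'M[R]_n.+1 => M u v) (etrans xy (esym x0y)).
  by rewrite !mxE vn.
rewrite card_family foldrE big_map big_enum /=.
apply: (@leq_trans (\prod_(i < n.+1) q ^ (\sum_(i.+1 <= l < n.+1) b l))%N).
  by apply: leq_prod => i _; apply: card_ann cR _.
by rewrite -!expn_sum sum_tails.
Qed.

End HessenbergCount.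

Lemma char_poly_conjugate (R : comNzRingType) n (P Q x : 'M[R]_n) :
  P *m Q = 1%:M -> char_poly (P *m x *m Q) = char_poly x.
Proof.
move=> PQ; rewrite /char_poly.
have -> : char_poly_mx (P *m x *m Q) =
    map_mx polyC P *m char_poly_mx x *m map_mx polyC Q.
  rewrite /char_poly_mx mulmxBr mulmxBl -!map_mxM; congr (_ - _).
  by rewrite mul_mx_scalar -scalemxAl -map_mxM PQ map_mx1 scalemx1.
by rewrite !det_mulmx mulrAC -det_mulmx -map_mxM PQ map_mx1 det1 mul1r.
Qed.

(** * Reduction of all matrices to Hessenberg form by conjugation *)

Section RowReduction.
Variables (R : finComNzRingType) (t : R) (N q n : nat).
Hypothesis cR : chain_ring t N q.
Implicit Types (b : nat -> nat) (c : {poly R}) (x y : 'M[R]_n.+1).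

(* A row of minimal valuation beta is t^beta times a vector with a unit
   coordinate, and that vector can be completed to an invertible matrix. *)
Lemma row_reduction r (r' : 'I_n.+1) (w : {ffun 'I_r -> R}) : r = r'.+1 ->
  exists beta : 'I_N.+1, (forall i, tdiv t beta (w i)) /\
    exists P Q : 'M[R]_n.+1, [/\ P *m Q = 1%:M,
      forall i : 'I_n.+1, (r <= i)%N -> row i P = delta_mx 0 i &
      forall i : 'I_n.+1, (i < r)%N -> forall j : 'I_r, i = j :> nat ->
        t ^+ beta * P r' i = w j] /\
      (forall i : 'I_n.+1, (r <= i)%N -> P r' i = 0).
Proof.
move=> rE.
have /fin_all_exists[v vP] (i : 'I_r) : exists buv : 'I_N.+1 * (R * R),
    w i = t ^+ buv.1 * buv.2.1 /\ buv.2.1 * buv.2.2 = 1.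
  have [b [u [u' [bN wE uu]]]] := chain_fact cR (w i).
  by exists (inord b, (u, u')); rewrite /= inordK.
have r0 : (0 < r)%N by rewrite rE.
pose p := [arg min_(i < Ordinal r0) (v i).1]%N.
have pmin i : ((v p).1 <= (v i).1)%N.
  by rewrite /p; case: arg_minnP => // j _ /(_ i); apply.
pose w' i := t ^+ ((v i).1 - (v p).1) * (v i).2.1.
have w'E i : t ^+ (v p).1 * w' i = w i.
  by rewrite mulrA -exprD subnKC // -(proj1 (vP i)).
have w'p : w' p * (v p).2.2 = 1 by rewrite /w' subnn mul1r (proj2 (vP p)).
exists (v p).1; split=> [i|]; first by apply/tdivP; exists (w' i).
have rn : (r <= n.+1)%N by rewrite rE.
pose p' := widen_ord rn p.
pose om : 'rV[R]_n.+1 := \row_i (if insub (val i) is Some j then w' j else 0).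
pose de : 'cV[R]_n.+1 := delta_mx p' 0.
pose z := om - delta_mx 0 p'.
pose u' := (v p).2.2.
have omp : om 0 p' = w' p.
  rewrite mxE /= insubT //= => pr; congr w'; exact/val_inj.
have zde : z *m de = (w' p - 1)%:M.
  apply/matrixP => i j; rewrite !ord1 mxE (bigD1 p') //= big1 => [|l lp].
    rewrite addr0 !mxE !eqxx mulr1 insubT //= => pr.
    by rewrite mulr1n; congr (w' _ - _); exact/val_inj.
  by rewrite [de _ _]mxE (negbTE lp) mulr0.
(* [P1] is the identity with row p' replaced by [om]. For D = [de *m z] one has D^2 = ([w' p] - 1)
   D, and [w' p] is a unit with inverse [u']; hence the inverse of 1 + D is 1 - [u'] D. *)
pose P1 := 1%:M + de *m z.
pose Q1 := 1%:M - u' *: (de *m z).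
have PQ1 : P1 *m Q1 = 1%:M.
  have DD : de *m z *m (de *m z) = (w' p - 1) *: (de *m z).
    by rewrite mulmxA -(mulmxA de z) zde mul_mx_scalar scalemxAl.
  rewrite /P1 /Q1 mulmxBr mulmx1 -scalemxAr mulmxDl mul1mx DD scalerBl scale1r.
  by rewrite subrKC scalerA mulrC w'p scale1r addrK.
(* The transposition brings [om] to row r', the last of the first r rows. *)
pose S : 'M[R]_n.+1 := tperm_mx r' p'.
have rowS i : row i (S *m P1) = row (tperm r' p' i) P1.
  by rewrite /S /tperm_mx -row_permE; apply/rowP => l; rewrite !mxE.
have rowP1 i : i != p' -> row i P1 = delta_mx 0 i.
  move=> ip; rewrite /P1 linearD /= row_mul row1.
  rewrite (_ : row i de = 0) ?mul0mx ?addr0 //.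
  by apply/rowP => l; rewrite !mxE (negbTE ip).
have rowPp : row p' P1 = om.
  rewrite /P1 linearD /= row_mul row1.
  rewrite (_ : row p' de = 1%:M) ?mul1mx ?subrKC //.
  by apply/rowP => l; rewrite !mxE ord1 !eqxx.
have Pr' i : (S *m P1) r' i = om 0 i.
  by have /rowP/(_ i) := rowS r'; rewrite tpermL rowPp mxE.
exists (S *m P1), (Q1 *m S); split; [split|].
- rewrite mulmxA -(mulmxA S) PQ1 mulmx1 /S /tperm_mx -perm_mxM.
  by rewrite tperm2 perm_mx1.
- move=> i ri; rewrite rowS tpermD ?rowP1 //.
  + by rewrite -val_eqE /= gtn_eqF // (leq_trans _ ri).
  + by rewrite -val_eqE /= ltn_eqF // -?rE //.
  + by rewrite -val_eqE /= ltn_eqF // (leq_trans _ ri).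
- move=> i ir j ij; rewrite Pr' mxE insubT //= -w'E; congr (_ * w' _).
  exact/val_inj.
- by move=> i ri; rewrite Pr' mxE insubF // ltnNge ri.
Qed.

Definition update_at b r beta := fun l : nat => if l == r then beta else b l.

(** The matrices are sorted by the first r entries w of row r. Conjugation by the matrix attached to
    w turns these entries into (0, ..., 0, t^beta) and keeps the Hessenberg rows below; at most
    q^((N - beta) r) vectors w are divisible by t^beta. *)
Lemma card_hess_step r b c : (0 < r <= n)%N ->
  (#|hess_fibre t n r.+1 b c| <= \sum_(beta < N.+1)
     q ^ ((N - beta) * r) * #|hess_fibre t n r (update_at b r beta) c|)%N.
Proof.
move=> /andP[r0 rn]; set S := hess_fibre t n r.+1 b c.
pose rr : 'I_n.+1 := Ordinal (rn : r < n.+1)%N.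
pose r' : 'I_n.+1 := inord r.-1.
have r'E : r' = r.-1 :> nat by rewrite inordK // ltnS (leq_trans _ rn) // leq_pred.
have rr' : r = r'.+1 by rewrite r'E prednK.
have rn1 : (r <= n.+1)%N by exact: leqW.
pose g x := [ffun i : 'I_r => x rr (widen_ord rn1 i)].
have /fin_all_exists[beta /all_and2[bd bP]] (w : {ffun 'I_r -> R}) := row_reduction w rr'.
have Sw w : (#|[set x in S | g x == w]| <=
    #|hess_fibre t n r (update_at b r (beta w)) c|)%N.
  have [P [Q [[PQ Prow Pw] Pz]]] := bP w.
  have QP : Q *m P = 1%:M by exact: mulmx1C.
  have dP (i : 'I_n.+1) : (r <= i)%N -> delta_mx 0 i *m P = delta_mx 0 i :> 'rV[R]_n.+1.
    by move=> ri; rewrite -rowE Prow.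
  have dQ (i : 'I_n.+1) : (r <= i)%N -> delta_mx 0 i *m Q = delta_mx 0 i :> 'rV[R]_n.+1.
    by move=> ri; rewrite -{1}(dP i ri) -mulmxA PQ mulmx1.
  rewrite -(card_in_imset (f := fun x => P *m x *m Q)); last first.
    move=> x y _ _ /(congr1 (fun z => Q *m z *m P)).
    by rewrite !mulmxA QP !mul1mx -!mulmxA QP !mulmx1.
  apply/subset_leq_card/subsetP => _ /imsetP[x + ->].
  rewrite !inE => /andP[/andP[/hessP xh /eqP xc] /eqP gx].
  rewrite char_poly_conjugate // xc eqxx andbT.
  have rowx (i : 'I_n.+1) : (r <= i)%N -> row i (P *m x *m Q) = row i x *m Q.
    by move=> ri; rewrite !row_mul Prow // -rowE.
  (* Up to a combination of the e_j with r <= j, which [Q] fixes, [y] is a times row r' of [P], and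
     [Q] sends that row to e_r'. *)
  have xQ (y : 'rV[R]_n.+1) a : (forall j : 'I_n.+1, (j < r)%N -> y 0 j = a * P r' j) ->
      forall j : 'I_n.+1, (j < r)%N -> (y *m Q) 0 j = a * (r' == j)%:R.
    move=> ya.
    have -> : y = a *: row r' P + \sum_(j < n.+1 | (r <= j)%N) y 0 j *: delta_mx 0 j.
      apply/rowP => j; rewrite !mxE summxE; case: (ltnP j r) => jr.
        rewrite big1 ?addr0 ?ya // => l rl.
        rewrite !mxE (_ : (j == l) = false) ?andbF ?mulr0 //.
        by rewrite -val_eqE ltn_eqF // (leq_trans jr).
      rewrite Pz // mulr0 add0r (bigD1 j) //= big1 ?addr0 => [|l /andP[_ lj]].
        by rewrite !mxE !eqxx mulr1.
      by rewrite !mxE [j == l]eq_sym (negbTE lj) andbF mulr0.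
    move=> j jr; rewrite mulmxDl mulmx_suml -scalemxAl -row_mul PQ row1 !mxE.
    rewrite eqxx summxE big1 ?addr0 /= 1?eq_sym // => l rl.
    rewrite -scalemxAl dQ // !mxE (_ : (j == l) = false) ?andbF ?mulr0 //.
    by rewrite -val_eqE ltn_eqF // (leq_trans jr).
  apply/hessP => i j ri ji.
  have -> : (P *m x *m Q) i j = (row i x *m Q) 0 j by rewrite -rowx // [in RHS]mxE.
  have [ir|ir] := eqVneq (i : nat) r.
    have jr : (j < r)%N by rewrite -ir.
    have -> : i = rr by exact/val_inj.
    rewrite (xQ _ (t ^+ beta w) _ j jr) => [|l lr].
      rewrite /update_at eqxx -val_eqE /= r'E -eqSS prednK //.
      by case: ifP; rewrite ?mulr1 ?mulr0.
    by rewrite mxE (Pw l _ (Ordinal lr)) // -gx ffunE; congr (x rr _); apply/val_inj.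
  have {}ri : (r < i)%N by rewrite ltn_neqAle eq_sym ir.
  rewrite /update_at (negbTE ir).
  (* For i > r, row i vanishes before column i - 1 >= r, so [Q] fixes it. *)
  have -> : row i x *m Q = row i x.
    have -> : row i x = \sum_(l < n.+1 | (r <= l)%N) x i l *: delta_mx 0 l.
      rewrite [LHS]row_sum_delta (bigID (fun l : 'I_n.+1 => (r <= l)%N)) /=.
      rewrite [X in _ + X]big1 ?addr0 => [|l lr].
        by apply: eq_bigr => l _; rewrite mxE.
      rewrite -ltnNge in lr; rewrite mxE xh ?(ltn_trans lr) //.
      by rewrite gtn_eqF ?scale0r // (leq_trans _ ri).
    by rewrite mulmx_suml; apply: eq_bigr => l rl; rewrite -scalemxAl dQ.
  by rewrite mxE xh.
have -> : #|S| = (\sum_w #|[set x in S | g x == w]|)%N.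
  rewrite -sum1_card (partition_big g predT) //=.
  by apply: eq_bigr => w _; rewrite sum1dep_card.
apply: leq_trans (leq_sum _ (fun w _ => Sw w)) _.
rewrite (partition_big beta predT) //=; apply: leq_sum => be _.
rewrite (eq_bigr (fun=> #|hess_fibre t n r (update_at b r be) c|)); last first.
  by move=> w /eqP ->.
rewrite sum_nat_const leq_mul2r; apply/orP; right.
apply: (@leq_trans #|(family (fun i : 'I_r => [pred z | tdiv t be z])
    : {pred {ffun 'I_r -> R}})|).
  apply/subset_leq_card/subsetP => w /eqP <-; apply/familyP => i; rewrite inE.
  exact: bd.
rewrite card_family foldrE big_map big_enum /=.
rewrite (eq_bigr (fun=> q ^ (N - be))%N) => [|i _]; last first.
  by rewrite (chain_card cR) // -ltnS.
by rewrite prod_nat_const card_ord -expnM.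
Qed.

(** The ceiling takes each value M > 0 for d values of beta, so a geometric series dominates the
    sum. In the induction d q^(N - M) is a reserve: since q >= 2, it pays for the next d terms and
    for the next reserve. *)
Lemma sum_cdiv d : (0 < d)%N ->
  (\sum_(beta < N.+1) q ^ (N - cdiv d beta) <= d.+1 * q ^ N)%N.
Proof.
move=> d0; have q1 := chain_gt1 cR.
suff sM M : (M <= N)%N -> (\sum_(0 <= beta < (d * M).+1) q ^ (N - cdiv d beta) +
    d * q ^ (N - M) <= d.+1 * q ^ N)%N.
  have NdN : (N <= d * N)%N by exact: leq_pmull.
  apply: leq_trans (sM N (leqnn N)).
  rewrite -(big_mkord xpredT (fun be => q ^ (N - cdiv d be))%N).
  by rewrite [X in (_ <= X + _)%N](big_cat_nat _ (n := N.+1)) //= -addnA leq_addr.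
elim: M => [_|M IH MN].
  by rewrite muln0 big_nat1 /cdiv add0n divn_small ?prednK // subn0; lia.
apply: leq_trans (IH (ltnW MN)).
have lo : ((d * M).+1 <= (d * M.+1).+1)%N by rewrite mulnS ltnS leq_addl.
rewrite (big_cat_nat _ (n := (d * M).+1)) //= -addnA leq_add2l.
rewrite (eq_big_nat _ _ (F2 := fun=> (q ^ (N - M.+1))%N)) => [|be /andP[bl bu]]; last first.
  have -> // : cdiv d be = M.+1.
  rewrite /cdiv; apply/eqP; rewrite eqn_leq -ltnS ltn_divLR // leq_divRL //.
  by rewrite mulnS in bu; rewrite !mulSn !(mulnC M); lia.
rewrite sum_nat_const_nat (_ : ((d * M.+1).+1 - (d * M).+1 = d)%N); last by rewrite mulnS; lia.
rewrite -mulnDr leq_mul2l; apply/orP; right.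
by rewrite -[(N - M)%N]prednK ?subn_gt0 // -subnS expnS; nia.
Qed.

(** The factors l < r are those whose exponent has been summed over. In the next sum the weight
    q^((N - beta) r.+1) of [card_hess_step] cancels q^(r.+1 beta) up to a constant power of q; only
    the series of [sum_cdiv] remains, which contributes n.+2 q^N. *)
Lemma card_hess_fibre_le r b c : (r <= n)%N -> (forall l, (b l <= N)%N) ->
  (#|hess_fibre t n r.+1 b c| <=
    \prod_(l < n) (if (l < r)%N then q ^ (2 * N * l.+1) * (n.+1 * n.+2) else
       q ^ (N * l) * (n.+1 * q ^ (N - cdiv n.+1 (b l.+1))) * q ^ (l.+1 * b l.+1)))%N.
Proof.
elim: r b => [b _ bN|r IH b rn bN].
  by apply: leq_trans (card_hess_fibre n cR c bN) _.
apply: leq_trans (card_hess_step _ _ _) _; first by rewrite rn.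
pose rr := Ordinal rn.
set W := (\prod_(l < n | l != rr)
       (if (l < r.+1)%N then q ^ (2 * N * l.+1) * (n.+1 * n.+2) else
       q ^ (N * l) * (n.+1 * q ^ (N - cdiv n.+1 (b l.+1))) * q ^ (l.+1 * b l.+1)))%N.
apply: (@leq_trans (\sum_(be < N.+1) q ^ ((N - be) * r.+1) *
   ((q ^ (N * r) * (n.+1 * q ^ (N - cdiv n.+1 be)) * q ^ (r.+1 * be)) * W))%N).
  apply: leq_sum => be _; apply: leq_mul => //.
  apply: leq_trans (IH _ (ltnW rn) _) _.
    by move=> l; rewrite /update_at; case: ifP => // _; rewrite -ltnS.
  rewrite (bigD1 rr) //= ltnn /update_at eqxx leq_mul //.
  apply: leq_prod => l lr; rewrite eqSS.
  have -> : (l == r :> nat) = false by apply/negbTE; rewrite -val_eqE in lr.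
  rewrite ltnS [(l <= r)%N]leq_eqVlt.
  by rewrite -[(l == r :> nat)]/(val l == val rr) val_eqE (negbTE lr).
rewrite (bigD1 rr) //= ltnSn -/W.
rewrite (eq_bigr (fun be : 'I_N.+1 => (q ^ (N - cdiv n.+1 be)) *
    (q ^ (N * r.+1 + N * r) * n.+1 * W))%N) => [|be _]; last first.
  have be_le : (be <= N)%N by rewrite -ltnS.
  have E : (q ^ ((N - be) * r.+1) * q ^ (r.+1 * be) = q ^ (N * r.+1))%N.
    by rewrite -expnD (mulnC r.+1) -mulnDl subnK.
  by rewrite expnD -E; lia.
rewrite -big_distrl /= mulnA leq_mul2r; apply/orP; right.
rewrite !mulnA.
apply: leq_trans (leq_mul (leq_mul (sum_cdiv (ltn0Sn n)) (leqnn _)) (leqnn _)) _.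
have -> : (2 * N * r.+1 = N + (N * r.+1 + N * r))%N by rewrite mulnS; lia.
by rewrite [X in (_ <= X * _ * _)%N]expnD; lia.
Qed.

(** For r = n.+1 the Hessenberg condition is empty, so any b serves, and the exponents 2 N (l + 1)
    add up to N n (n + 1). *)
Theorem card_char_poly_fibre c :
  (#|[set x : 'M[R]_n.+1 | char_poly x == c]| <=
     (n.+1 * n.+2) ^ n * q ^ (N * (n * n.+1)))%N.
Proof.
apply: leq_trans (_ : #|hess_fibre t n n.+1 (fun=> 0%N) c| <= _)%N.
  apply/subset_leq_card/subsetP => x; rewrite !inE => ->; rewrite andbT.
  by apply/hessP => i j; rewrite leqNgt ltn_ord.
apply: leq_trans (card_hess_fibre_le _ _ _) _ => //.
rewrite (eq_bigr (fun l : 'I_n => q ^ (2 * N * l.+1) * (n.+1 * n.+2))%N); last first.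
  by move=> l _; rewrite ltn_ord.
rewrite big_split /= prod_nat_const card_ord mulnC leq_mul2l -expn_sum.
apply/orP; right; rewrite leq_exp2l ?(chain_gt1 cR) //.
rewrite -big_distrr /= (mulnC 2%N) -mulnA leq_mul2l; apply/orP; right.
rewrite big_distrr /=; elim: n => [|m IH]; first by rewrite big_ord0.
by rewrite big_ord_recr /=; lia.
Qed.

End RowReduction.

HB.instance Definition _ (R : finComNzRingType) (h : {poly R}) := Finite.on {poly %/ h}.

(** * Truncated power series *)

Section PowerSeries.
Variable k : fieldType.
Implicit Types f g : fps k.

Lemma fps_coefM f g n :
  fps_coef (f * g) n = \sum_(i < n.+1) fps_coef f i * fps_coef g (n - i)%N.
Proof. by []. Qed.

Lemma fps_coefD f g n : fps_coef (f + g) n = fps_coef f n + fps_coef g n.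
Proof. by []. Qed.

(** The coefficients of the inverse are solved for one after the other; [G n] is a table that is
    correct up to index n. *)
Lemma fps_inverse f : fps_coef f 0 != 0 -> exists g, f * g = 1.
Proof.
move=> f0.
pose step n (G : nat -> k) j := if (j <= n)%N then G j else
  - (fps_coef f 0)^-1 * \sum_(i < n.+1) G i * fps_coef f (n.+1 - i)%N.
pose G := fix G n := if n is n'.+1 then step n' (G n') else fun=> (fps_coef f 0)^-1.
have GE n : forall j, (j <= n)%N -> G n j = G j j.
  elim: n => [j|n IH j]; first by rewrite leqn0 => /eqP ->.
  rewrite leq_eqVlt => /predU1P[-> //|jn].
  by rewrite /= /step -ltnS jn IH.
exists (Fps (fun n => G n n)); rewrite mulrC; apply: fpsP => -[|n].
  by rewrite /= big_ord1 mulVf.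
rewrite /= big_ord_recr /= subnn /step ltnn mulrAC mulNr mulVf // mulN1r.
apply/eqP; rewrite subr_eq0; apply/eqP; apply: eq_bigr => i _.
by rewrite GE // -ltnS.
Qed.

Lemma fps_coef_tM f n :
  fps_coef (fps_t k * f) n = if n is n'.+1 then fps_coef f n' else 0.
Proof.
rewrite fps_coefM; case: n => [|n]; first by rewrite big_ord1 mul0r.
rewrite big_ord_recl /= mul0r add0r big_ord_recl /= mul1r subn1 /=.
by rewrite big1 ?addr0 // => i _; rewrite mul0r.
Qed.

Lemma fps_tXE e f n :
  fps_coef (fps_t k ^+ e * f) n = if (n < e)%N then 0 else fps_coef f (n - e).
Proof.
elim: e n => [|e IH] n; first by rewrite mul1r subn0.
by rewrite exprS -mulrA fps_coef_tM; case: n => [|n] //; rewrite IH.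
Qed.

Lemma fps_tX_dvd e f : (forall i, (i < e)%N -> fps_coef f i = 0) ->
  exists g, f = fps_t k ^+ e * g.
Proof.
move=> f0; exists (Fps (fun n => fps_coef f (n + e))); apply: fpsP => n.
by rewrite fps_tXE; case: ltnP => [/f0 //|en] /=; rewrite subnK.
Qed.

Lemma fps_valuation f : f != 0 -> exists e u v, f = fps_t k ^+ e * u /\ u * v = 1.
Proof.
move=> /fps_neq0P[e fe lt]; have [u fE] := fps_tX_dvd (fun i ie => lt i ie).
have u0 : fps_coef u 0 != 0 by move: fe; rewrite fE fps_tXE ltnn subnn.
by have [v uv] := fps_inverse u0; exists e, u, v.
Qed.

Lemma fps_tX_neq0 e : fps_t k ^+ e != 0.
Proof.
apply/eqP => /(congr1 (fun f => fps_coef (f * 1) e)) /eqP.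
by rewrite fps_tXE ltnn subnn mul0r /= oner_eq0.
Qed.

End PowerSeries.

(** * The chain ring k[t]/(t^(N+1)) *)

Section Truncation.
Variables (k : finFieldType) (N : nat).
Implicit Types f g : fps k.

(* The modulus is t^(N+1) rather than t^N, so that the ring is never trivial. *)
Definition tring : finComNzRingType := {poly %/ ('X^(N.+1) : {poly k})}.

Definition red f : tring := in_qpoly 'X^(N.+1) (fps_trunc N.+1 f).

Definition tcoef (x : tring) i : k := (x : {poly %/ ('X^(N.+1) : {poly k})})`_i.

Lemma tcoef_in_qpoly (p : {poly k}) i :
  tcoef (in_qpoly 'X^(N.+1) p : tring) i = if (i < N.+1)%N then p`_i else 0.
Proof.
by rewrite /tcoef /in_qpoly /= mk_monic_Xn -Pdiv.RingMonic.take_poly_rmodp coef_take_poly.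
Qed.

Lemma tcoef_red f i : tcoef (red f) i = if (i < N.+1)%N then fps_coef f i else 0.
Proof. by rewrite tcoef_in_qpoly; case: ifP => // iN; rewrite coef_poly iN. Qed.

Lemma tcoefP (x y : tring) :
  (forall i, (i < N.+1)%N -> tcoef x i = tcoef y i) -> x = y.
Proof.
move=> xy; apply/val_inj/polyP => i; have [iN|Ni] := ltnP i N.+1; first exact: xy.
have sz (z : {poly %/ ('X^(N.+1) : {poly k})}) : (size z <= i)%N.
  rewrite (leq_trans _ Ni) // -ltnS (leq_trans (size_mk_monic z)) //.
  by rewrite mk_monic_Xn size_polyXn.
by rewrite !nth_default ?sz.
Qed.

Fact red_zmod_morphism : zmod_morphism red.
Proof.
move=> f g; rewrite /red -raddfB; congr in_qpoly; apply/polyP => i.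
by rewrite coefB !coef_poly; case: ifP => //; rewrite subr0.
Qed.

Fact red_monoid_morphism : monoid_morphism red.
Proof.
split=> [|f g].
  apply: tcoefP => i iN; rewrite tcoef_red iN -in_qpoly1 tcoef_in_qpoly iN.
  by rewrite coef1.
rewrite /red -rmorphM; apply: tcoefP => i iN.
by rewrite !tcoef_in_qpoly iN coef_poly iN -fps_mul_trunc.
Qed.

HB.instance Definition _ := GRing.isZmodMorphism.Build (fps k) tring red red_zmod_morphism.
HB.instance Definition _ := GRing.isMonoidMorphism.Build (fps k) tring red red_monoid_morphism.

Definition lift_red (x : tring) : fps k := Fps (tcoef x).

Lemma lift_redK : cancel lift_red red.
Proof. by move=> x; apply: tcoefP => i iN; rewrite tcoef_red iN. Qed.

Lemma red_eqP f g : red f = red g <-> exists h, f = g + fps_t k ^+ N.+1 * h.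
Proof.
split=> [fg|[h ->]].
  have [|h fgE] := @fps_tX_dvd k N.+1 (f - g).
    move=> i iN; have /(congr1 (fun x => tcoef x i)) := fg.
    by rewrite !tcoef_red iN => /eqP; rewrite -subr_eq0 => /eqP.
  by exists h; rewrite -fgE subrKC.
apply: tcoefP => i iN; rewrite !tcoef_red iN.
by rewrite fps_coefD fps_tXE iN addr0.
Qed.

Lemma red_chain_ring : chain_ring (red (fps_t k)) N.+1 #|k|.
Proof.
have tE e x : tcoef (red (fps_t k) ^+ e * x) =1
    fun i => if (i < N.+1)%N then if (i < e)%N then 0 else tcoef x (i - e) else 0.
  by move=> i; rewrite -{1}[x]lift_redK -rmorphXn -rmorphM tcoef_red fps_tXE.
have t0 (x : tring) e : (forall i, (i < e)%N -> tcoef x i = 0) ->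
    exists y, x = red (fps_t k) ^+ e * y.
  move=> x0; have [g xg] := @fps_tX_dvd k e (lift_red x) x0.
  by exists (red g); rewrite -rmorphXn -rmorphM -xg /= lift_redK.
have tc0 i : tcoef (0 : tring) i = 0 by rewrite /tcoef /= coef0.
split.
- exact: card_finNzRing_gt1.
- by apply: tcoefP => i iN; rewrite -[_ ^+ _]mulr1 tE iN tc0.
- move=> m mN; apply/eqP => /(congr1 (fun x => tcoef (x * 1) m)).
  rewrite tE mN ltnn subnn mul0r tc0 => /eqP.
  by rewrite -(rmorph1 red) tcoef_red /= oner_eq0.
- move=> x; have [x0|] := eqVneq (lift_red x) 0.
    (* Zero is written as t^(N+1) times the unit 1. *)
    exists N.+1, 1, 1; rewrite leqnn !mulr1; split=> //.
    apply: tcoefP => i iN; rewrite -[_ ^+ _]mulr1 tE iN.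
    by have /(congr1 (fun f => fps_coef f i)) := x0.
  move=> /[dup] /fps_valuation[e [u [v [xE uv]]]] x0.
  exists e, (red u), (red v); rewrite -rmorphM uv rmorph1; split=> //.
    rewrite leqNgt; apply/negP => Ne; case/eqP: x0; apply: fpsP => i.
    rewrite xE fps_tXE; case: ltnP => // ei.
    have : fps_coef (lift_red x) i = 0.
      rewrite /= /tcoef nth_default //; apply: (@leq_trans N.+1); last by lia.
      rewrite -ltnS (leq_trans (size_mk_monic (_ : {poly %/ ('X^(N.+1) : {poly k})}))) //.
      by rewrite mk_monic_Xn size_polyXn.
    by rewrite xE fps_tXE ltnNge ei.
  by rewrite -rmorphXn -rmorphM -xE /= lift_redK.
- move=> e eN.
  (* [F] parametrizes the ideal (t^e) by the coefficients of degrees e to N. *)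
  pose F (g : {ffun 'I_(N.+1 - e) -> k}) : tring :=
    red (fps_t k ^+ e * Fps (fun i => if insub i is Some j then g j else 0)).
  have Fcoef (g : {ffun 'I_(N.+1 - e) -> k}) (j : 'I_(N.+1 - e)) : tcoef (F g) (j + e) = g j.
    rewrite tcoef_red fps_tXE /= addnK valK.
    by have := ltn_ord j; rewrite ltn_subRL addnC => ->; rewrite ltnNge leq_addl.
  have Finj : injective F.
    by move=> g h gh; apply/ffunP => j; rewrite -!Fcoef gh.
  have -> : (#|k| ^ (N.+1 - e) = #|{ffun 'I_(N.+1 - e) -> k}|)%N by rewrite card_ffun card_ord.
  rewrite -(card_codom Finj); apply: eq_card => x; rewrite !inE.
  apply/tdivP/codomP => [[y xE]|[g ->]]; last first.
    by rewrite /F rmorphM rmorphXn; eexists.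
  exists [ffun j : 'I_(N.+1 - e) => tcoef y j]; apply: tcoefP => i iN.
  rewrite xE tE iN tcoef_red iN fps_tXE; case: ltnP => //= ei.
  have lt : (i - e < N.+1 - e)%N by lia.
  by rewrite (insubT (fun j => j < N.+1 - e)%N lt) ffunE.
Qed.

End Truncation.

Lemma card_red_char_poly (k : finFieldType) (N n : nat) (c : {poly tring k N}) :
  (#|[set x : 'M[tring k N]_n.+1 | char_poly x == c]| <=
     (n.+1 * n.+2) ^ n * #|tring k N| ^ (n * n.+1))%N.
Proof.
apply: leq_trans (card_char_poly_fibre n (red_chain_ring k N) c) _.
by rewrite (chain_cardR (red_chain_ring k N)) -expnM.
Qed.

Lemma chevalley_char_poly (A : comNzRingType) n (x y : 'M[A]_n.+1) :
  chevalley x = chevalley y -> char_poly x = char_poly y.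
Proof.
move=> /rowP h; apply/polyP => j; case: (ltngtP j n.+1) => jn.
- by have := h (Ordinal jn); rewrite !mxE.
- by rewrite !nth_default ?size_char_poly.
rewrite jn; have := char_poly_monic x; have := char_poly_monic y.
by rewrite !monicE !lead_coefE !size_char_poly /= => /eqP -> /eqP ->.
Qed.

Lemma card_chevalley_fibre (k : finFieldType) N n (S : {set 'rV[tring k N]_n.+1}) :
  (#|[set x : 'M[tring k N]_n.+1 | chevalley x \in S]| <=
    #|S| * ((n.+1 * n.+2) ^ n * #|tring k N| ^ (n * n.+1)))%N.
Proof.
rewrite -sum1_card (partition_big (@chevalley _ n.+1) [in S]) /=; last first.
  by move=> x; rewrite inE.
rewrite -sum_nat_const; apply: leq_sum => s sS; rewrite sum1dep_card.
set X := finset _; have [->|[x0 x0X]] := finset.set_0Vmem X; first by rewrite cards0.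
apply: leq_trans (card_red_char_poly n (char_poly x0)).
apply/subset_leq_card/subsetP => x; move: x0X; rewrite !inE.
move=> /andP[_ /eqP x0s] /andP[_ /eqP xs].
have h : chevalley x = chevalley x0.
  exact: etrans xs (esym x0s).
have h' := chevalley_char_poly h.
apply/eqP.
exact: h'.
Qed.

Lemma fraction_decomp (D : idomainType) (x : {fraction D}) :
  exists a b : D, b != 0 /\ x * tofrac b = tofrac a.
Proof.
elim/quotW: x => r; exists (\n_r), (\d_r); split; first exact: denom_ratioP.
apply/eqP; rewrite -[_ * _]/(FracField.mul _ _) !piE.
rewrite FracField.equivfE /FracField.mulf.
by rewrite !numden_Ratio ?(oner_eq0, mulf_neq0, denom_ratioP) // !mulr1 mulrC eqxx.
Qed.

Section Laurent.
Variable k : fieldType.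

(** Every denominator is a power of t times a unit, and the unit goes to the numerator. *)
Lemma laurent_decomp (x : laurent k) :
  exists M (h : fps k), tofrac (fps_t k ^+ M) * x = tofrac h.
Proof.
have [a [b [b0 xE]]] := fraction_decomp x.
have [e [u [v [bE uv]]]] := fps_valuation b0.
exists e, (a * v); rewrite [in RHS]tofracM -xE bE tofracM -2!mulrA -tofracM uv.
by rewrite tofrac1 mulr1 mulrC.
Qed.

End Laurent.

From mathcomp Require Import complex all_classical all_reals all_analysis.
From mathcomp Require Import measurable_realfun ring.

Import Num.Theory numFieldNormedType.Exports.

Local Open Scope classical_set_scope.
Local Open Scope ring_scope.

(** * The t-adic topology on matrices *)

Section MatrixTopology.
Variable k : fieldType.
Local Notation O := (fps k).
Local Notation F := (laurent k).
Local Notation t := (fps_t k).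

Lemma nbhs_laurentP (x : F) (A : set F) :
  nbhs x A <-> exists N, forall h : O, A (x + tofrac (t ^+ N * h)).
Proof.
split=> [|[N xA]].
  rewrite nbhsE => -[B [oB Bx] BA]; have [N xB] := oB _ Bx.
  by exists N => h; apply: BA.
rewrite nbhsE; exists [set y | exists h : O, y = x + tofrac (t ^+ N * h)].
  split; last by exists 0; rewrite mulr0 tofrac0 addr0.
  move=> _ [h ->]; exists N => h'; exists (h + h').
  by rewrite mulrDr tofracD addrA.
by move=> _ [h ->]; exact: xA.
Qed.

Variables m n : nat.

Definition emb (h : 'M[O]_(m, n)) : 'M[F]_(m, n) := map_mx (@tofrac O) h.

Lemma emb_inj : injective emb.
Proof.
move=> h h' /matrixP hh'; apply/matrixP => i j; have := hh' i j.
by rewrite !mxE => /eqP; rewrite tofrac_eq => /eqP.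
Qed.

Lemma embD h h' : emb (h + h') = emb h + emb h'.
Proof. exact: map_mxD. Qed.

Lemma nbhs_mxP (x : 'M[F]_(m, n)) (A : set 'M[F]_(m, n)) :
  nbhs x A <-> exists N, forall h : 'M[O]_(m, n), A (x + emb (t ^+ N *: h)).
Proof.
split=> [[P xP PA]|[N xA]].
  have /fin_all_exists[N NP] (ij : 'I_m * 'I_n) :
      exists N, forall h : O, P ij.1 ij.2 (x ij.1 ij.2 + tofrac (t ^+ N * h)).
    by apply/nbhs_laurentP; apply: xP.
  exists (\max_ij N ij)%N => h; apply: PA => i j; rewrite !mxE.
  have le : (N (i, j) <= \max_ij N ij)%N by exact: leq_bigmax.
  by rewrite -(subnK le) addnC exprD -mulrA; apply: (NP (i, j)).
exists (fun i j => [set y | exists h : O, y = x i j + tofrac (t ^+ N * h)]).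
  by move=> i j; apply/nbhs_laurentP; exists N => h; exists h.
move=> y xy; have /fin_all_exists[h hP] (ij : 'I_m * 'I_n) :
    exists h : O, y ij.1 ij.2 = x ij.1 ij.2 + tofrac (t ^+ N * h).
  exact: xy.
have -> : y = x + emb (t ^+ N *: \matrix_(i, j) h (i, j)); last exact: xA.
by apply/matrixP => i j; rewrite !mxE (hP (i, j)).
Qed.

Lemma mx_decomp (x : 'M[F]_(m, n)) :
  exists M (h : 'M[O]_(m, n)), tofrac (t ^+ M) *: x = emb h.
Proof.
have /fin_all_exists[M /fin_all_exists[h hP]] (ij : 'I_m * 'I_n) :
    exists M (h : O), tofrac (t ^+ M) * x ij.1 ij.2 = tofrac h.
  exact: laurent_decomp.
exists (\max_ij M ij)%N; exists (\matrix_(i, j) (t ^+ (\max_ij M ij - M (i, j))%N * h (i, j))).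
apply/matrixP => i j; rewrite !mxE.
have le : (M (i, j) <= \max_ij M ij)%N by exact: leq_bigmax.
by rewrite -{1}(subnK le) exprD tofracM -mulrA (hP (i, j)) tofracM.
Qed.

Definition lattice : set 'M[F]_(m, n) := range emb.

(** The entrywise product covers both the scaling of matrices by a power of t and the scaling of the
    coefficients of a polynomial by powers that depend on the degree. *)
Definition hadamard (a x : 'M[F]_(m, n)) : 'M[F]_(m, n) := \matrix_(i, j) (a i j * x i j).

Lemma hadamardD a x y : hadamard a (x + y) = hadamard a x + hadamard a y.
Proof. by apply/matrixP => i j; rewrite !mxE mulrDr. Qed.

Lemma hadamard_continuous a : continuous (hadamard a).
Proof.
move=> x A /nbhs_mxP[N xA]; apply/nbhs_mxP.
have [M [b aE]] := mx_decomp a; exists (M + N)%N => h /=.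
rewrite hadamardD.
have -> : hadamard a (emb (t ^+ (M + N) *: h)) =
    emb (t ^+ N *: \matrix_(i, j) (b i j * h i j)).
  apply/matrixP => i j; rewrite !mxE exprD -mulrA tofracM mulrCA.
  have /matrixP/(_ i j) := aE; rewrite !mxE mulrA => ->.
  by rewrite -tofracM mulrCA.
exact: xA.
Qed.

End MatrixTopology.

(** * The lattice of integral matrices and its open subsets *)

Section Lattice.
Variable k : finFieldType.
Variables m n : nat.
Local Notation O := (fps k).
Local Notation F := (laurent k).
Local Notation t := (fps_t k).
Local Notation V := 'M[F]_(m, n).

Lemma ultra_fin (T : Type) (I : finType) (G : set_system T) (f : T -> I) :
  UltraFilter G -> exists i, G (f @^-1` [set i]).
Proof.
move=> UG; apply: contrapT => nG.
have /filter_ex[x /(_ (f x))] : \forall x \near G, forall i, ~ (f @^-1` [set i]) x.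
  apply: filter_forall => i.
  by have [Gi|//] := in_ultra_setVsetC (f @^-1` [set i]) UG; case: nG; exists i.
exact.
Qed.

(** Along an ultrafilter each coefficient of each entry is constant on a large set, because [k] is
    finite; these constants are the coefficients of a limit. *)
Lemma lattice_compact : compact (@lattice k m n).
Proof.
rewrite compact_ultra => G UG GL.
(* [co] inverts [emb] on the lattice and has the default value 0 elsewhere. *)
pose co (x : V) : 'M[O]_(m, n) := xget 0 [set h | emb h = x].
have coK h : co (emb h) = h.
  by apply: emb_inj; apply: (@xgetPex _ 0 [set g | emb g = emb h]); exists h.
have /choice[a aP] (e : nat) : exists a : {ffun 'I_m * 'I_n -> k},
    G [set x | [ffun ij => fps_coef (co x ij.1 ij.2) e] = a].
  exact: (ultra_fin (fun x => [ffun ij => fps_coef (co x ij.1 ij.2) e])).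
pose h : 'M[O]_(m, n) := \matrix_(i, j) Fps (fun e => a e (i, j)).
exists (emb h); split; first by exists h.
move=> A /nbhs_mxP[N hA].
have : G [set x | forall e, (e < N)%N -> [ffun ij => fps_coef (co x ij.1 ij.2) e] = a e].
  elim: N {hA} => [|N IH]; first by apply: filterS filterT.
  apply: filterS (filterI IH (aP N)) => x [xN xe] e.
  by rewrite ltnS leq_eqVlt => /predU1P[->//|]; exact: xN.
move=> /(filterI GL); apply: filterS => _ [[g _ <-]]; rewrite /= coK => gN.
have /fin_all_exists[d dP] (ij : 'I_m * 'I_n) :
    exists d : O, g ij.1 ij.2 = h ij.1 ij.2 + t ^+ N * d.
  have [|d dE] := @fps_tX_dvd k N (g ij.1 ij.2 - h ij.1 ij.2).
    move=> e /gN/ffunP/(_ ij); rewrite ffunE => ge.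
    rewrite fps_coefD ge mxE; case: (ij) => i j /=; exact: subrr.
  by exists d; rewrite -dE subrKC.
have -> : g = h + t ^+ N *: \matrix_(i, j) d (i, j).
  by apply/matrixP => i j; rewrite !mxE (dP (i, j)) mxE.
by rewrite embD; exact: hA.
Qed.

(** A union of cosets of t^(N+1) times the lattice, given by their residues. *)
Definition level N (S : {set 'M[tring k N]_(m, n)}) : set V :=
  [set emb h | h in [set h | map_mx (@red k N) h \in S]].

Lemma level_emb N (S : {set 'M[tring k N]_(m, n)}) h :
  level S (emb h) <-> map_mx (@red k N) h \in S.
Proof. by split=> [[h' h'S /emb_inj <-]|hS] //; exists h. Qed.

Lemma map_red_eqP N (h g : 'M[O]_(m, n)) :
  map_mx (@red k N) h = map_mx (@red k N) g <->
  exists d, h = g + t ^+ N.+1 *: d.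
Proof.
split=> [/matrixP hg|[d ->]].
  have /fin_all_exists[d dP] (ij : 'I_m * 'I_n) :
      exists d : O, h ij.1 ij.2 = g ij.1 ij.2 + t ^+ N.+1 * d.
    by apply/red_eqP; have := hg ij.1 ij.2; rewrite !mxE.
  by exists (\matrix_(i, j) d (i, j)); apply/matrixP => i j; rewrite !mxE (dP (i, j)).
by apply/matrixP => i j; rewrite !mxE; apply/red_eqP; exists (d i j).
Qed.

Lemma map_lift_redK N (s : 'M[tring k N]_(m, n)) :
  map_mx (@red k N) (map_mx (@lift_red k N) s) = s.
Proof. by apply/matrixP => i j; rewrite !mxE lift_redK. Qed.

Lemma level_open N (S : {set 'M[tring k N]_(m, n)}) : open (level S).
Proof.
rewrite openE => _ [h hS <-]; apply/nbhs_mxP; exists N.+1 => d.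
rewrite -embD; apply/level_emb.
by have /map_red_eqP-> : exists d', h + t ^+ N.+1 *: d = h + t ^+ N.+1 *: d' by exists d.
Qed.

Lemma level_setT N : level [set: 'M[tring k N]_(m, n)] = @lattice k m n.
Proof. by apply/seteqP; split=> _ [h _ <-]; exists h => //; rewrite /= inE. Qed.

Lemma lattice_open : open (@lattice k m n).
Proof. by rewrite -(level_setT 0); exact: level_open. Qed.

(** The residues whose whole coset lies in [U]; they give the largest union of such cosets inside
    [U]. *)
Definition sub_level N (U : set V) : {set 'M[tring k N]_(m, n)} :=
  [set s | `[< forall h, map_mx (@red k N) h = s -> U (emb h) >]].

Lemma level_sub_level N (U : set V) : level (sub_level N U) `<=` U.
Proof. by move=> _ [h + <-]; rewrite /= inE => /asboolP; exact. Qed.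

Lemma bigcup_sub_level (U : set V) : open U ->
  U `&` @lattice k m n = \bigcup_N level (sub_level N U).
Proof.
move=> oU; apply/seteqP; split=> [x [Ux [h _ xE]]|x [N _ xN]]; last first.
  split; first exact: level_sub_level xN.
  by case: xN => h _ <-; exists h.
move: Ux; rewrite -xE => /[dup] Uh; rewrite openE in oU; move=> /oU/nbhs_mxP[N hU].
exists N => //; exists h => //; rewrite /= inE; apply/asboolP => g /map_red_eqP[d ->].
by rewrite exprS mulrC -scalerA embD; exact: hU.
Qed.

Lemma level_refine N M (S : {set 'M[tring k N]_(m, n)}) : (N <= M)%N ->
  exists S' : {set 'M[tring k M]_(m, n)}, level S' = level S.
Proof.
move=> NM; exists (sub_level M (level S)).
apply/seteqP; split; first exact: level_sub_level.
move=> _ [h hS <-]; exists h => //; rewrite /= inE; apply/asboolP => g /map_red_eqP[d ->].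
have <- : (M - N + N.+1 = M.+1)%N by rewrite addnS subnK.
apply/level_emb; rewrite addnC exprD -scalerA.
have /map_red_eqP-> // : exists d',
  h + t ^+ N.+1 *: (t ^+ (M - N) *: d) = h + t ^+ N.+1 *: d' by eexists.
Qed.

End Lattice.

(** * Homogeneity and continuity of the Chevalley map *)

Lemma chevalley_map (A B : comNzRingType) (f : {rmorphism A -> B}) n (x : 'M[A]_n) :
  chevalley (map_mx f x) = map_mx f (chevalley x).
Proof. by apply/rowP => j; rewrite !mxE -map_char_poly coef_map. Qed.

(** Substituting a X for X in det (X - a x) gives a^n det (X - x); the coefficients of degree j are
    compared. *)
Lemma coef_char_polyZ (A : fieldType) n (a : A) (x : 'M[A]_n) j : a != 0 ->
  (char_poly (a *: x))`_j * a ^+ j = a ^+ n * (char_poly x)`_j.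
Proof.
move=> a0; have comp : char_poly (a *: x) \Po (a *: 'X) = a ^+ n *: char_poly x.
  rewrite /char_poly -[LHS]det_map_mx /= -[a ^+ n *: _]mul_polyC polyC_exp -detZ.
  congr (\det _).
  apply/matrixP => i l; rewrite !mxE /= comp_polyB comp_polyC polyCM.
  case: (i == l); rewrite ?mulr1n ?mulr0n ?comp_polyX ?comp_poly0 mulrBr mul_polyC //.
  - by rewrite mul_polyC.
  - by rewrite mulr0.
have := congr1 (fun p : {poly A} => p`_j) comp; rewrite coefZ => <- {comp}.
rewrite comp_polyE; move: (char_poly (a *: x)) => p; rewrite coef_sum.
under eq_bigr => i _ do rewrite exprZn !coefZ coefXn.
have [sj|js] := ltnP j (size p).
  rewrite (bigD1 (Ordinal sj)) //= eqxx mulr1 big1 ?addr0 // => i ij.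
  rewrite (_ : (j == i) = false) ?mulr0 //; apply/negbTE; rewrite eq_sym.
  by rewrite -val_eqE in ij.
rewrite nth_default // mul0r big1 // => i _.
rewrite (_ : (j == i) = false) ?mulr0 //; apply/negbTE.
by rewrite neq_ltn (leq_trans (ltn_ord i)) ?orbT.
Qed.

Lemma chevalleyZ (k : fieldType) n (a : laurent k) (x : 'M[laurent k]_n) : a != 0 ->
  chevalley (a *: x) = hadamard (\row_j a ^+ (n - j)) (chevalley x).
Proof.
move=> a0; apply/rowP => j; rewrite !mxE; apply: (mulIf (expf_neq0 j a0)).
rewrite coef_char_polyZ // mulrAC -exprD subnK //; exact: ltnW.
Qed.

Section ChevalleyContinuous.
Variables (k : finFieldType) (n : nat).
Local Notation O := (fps k).
Local Notation F := (laurent k).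
Local Notation t := (fps_t k).

Lemma chevalley_emb (h : 'M[O]_n) : chevalley (emb h) = emb (chevalley h).
Proof. exact: (chevalley_map (@tofrac O)). Qed.

Lemma chevalley_red N (h : 'M[O]_n) :
  chevalley (map_mx (@red k N) h) = map_mx (@red k N) (chevalley h).
Proof. exact: chevalley_map. Qed.

Definition tpow M : F := tofrac (t ^+ M).

Lemma tpow_neq0 M : tpow M != 0.
Proof. by rewrite tofrac_eq0 fps_tX_neq0. Qed.

Definition scale_mx m l M : 'M[F]_(m, l) -> 'M[F]_(m, l) := hadamard (const_mx (tpow M)).

Definition scale_char M : 'rV[F]_n -> 'rV[F]_n := hadamard (\row_j tpow M ^+ (n - j)).

Definition unscale_char M : 'rV[F]_n -> 'rV[F]_n := hadamard (\row_j (tpow M ^+ (n - j))^-1).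

Lemma scale_charK M : cancel (scale_char M) (unscale_char M).
Proof.
move=> c; apply/rowP => j; rewrite !mxE mulrA mulVf ?mul1r //.
exact: expf_neq0 (tpow_neq0 M).
Qed.

Lemma chevalley_scale M (x : 'M[F]_n) :
  chevalley (scale_mx M x) = scale_char M (chevalley x).
Proof.
have -> : scale_mx M x = tpow M *: x by apply/matrixP => i j; rewrite !mxE.
exact: (chevalleyZ x (tpow_neq0 M)).
Qed.

(** On the lattice, [chevalley] commutes with reduction modulo t^(N+1). Any other point is brought
    into the lattice by a power of t, and homogeneity undoes this scaling on the coefficients. *)
Lemma chevalley_continuous : continuous (@chevalley F n).
Proof.
have on_lattice x : lattice x -> {for x, continuous (@chevalley F n)}.
  move=> [h _ <-] A; rewrite /prop_for chevalley_emb => /nbhs_mxP[N hA].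
  apply/nbhs_mxP; exists N.+1 => d /=; rewrite -embD chevalley_emb.
  have /map_red_eqP[d' ->] : map_mx (@red k N) (chevalley (h + t ^+ N.+1 *: d)) =
      map_mx (@red k N) (chevalley h).
    by rewrite -!chevalley_red; congr chevalley; apply/map_red_eqP; exists d.
  by rewrite exprS mulrC -scalerA embD; exact: hA.
move=> x; have [M [h xh]] := mx_decomp x.
have -> : @chevalley F n = unscale_char M \o (@chevalley F n \o @scale_mx n n M).
  by apply/funext => y /=; rewrite chevalley_scale scale_charK.
have xL : lattice (scale_mx M x).
  by exists h => //; rewrite -xh; apply/matrixP => i j; rewrite !mxE.
apply: continuous_comp; last exact: hadamard_continuous.
by apply: continuous_comp; [exact: hadamard_continuous|exact: on_lattice].
Qed.

End ChevalleyContinuous.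

(** * Haar measures of preimages *)

Section ApproximationByAlgebra.
Context d (T : measurableType d) (R : realType) (rho : {measure set T -> \bar R}).
Hypothesis rho_fin : (rho setT < +oo)%E.
Variable G : set (set T).
Hypotheses (G0 : G set0) (Gm : G `<=` measurable)
  (GC : forall A, G A -> G (~` A)) (GU : forall A B, G A -> G B -> G (A `|` B)).

Definition approximable A := measurable A /\ forall e : R, 0 < e ->
  exists2 B, G B & (rho ((A `\` B) `|` (B `\` A)) <= e%:E)%E.

Lemma approximable_base A : G A -> approximable A.
Proof.
move=> GA; split=> [|e e0]; first exact: Gm.
by exists A => //; rewrite setDv setU0 measure0 lee_fin ltW.
Qed.

Lemma approximableC A : approximable A -> approximable (~` A).
Proof.
move=> [mA aA]; split=> [|e /aA[B GB AB]]; first exact: measurableC.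
exists (~` B); first exact: GC.
have CD (X Y : set T) : ~` X `\` ~` Y = Y `\` X by rewrite !setDE setCK setIC.
by rewrite !CD setUC.
Qed.

Lemma approximableU A B : approximable A -> approximable B -> approximable (A `|` B).
Proof.
move=> [mA aA] [mB aB]; split=> [|e e0]; first exact: measurableU.
have e2 : 0 < e / 2 by rewrite divr_gt0.
have [A' GA AA] := aA _ e2; have [B' GB BB] := aB _ e2.
have [mA' mB'] := (Gm GA, Gm GB).
exists (A' `|` B'); first exact: GU.
rewrite [e]splitr EFinD; apply: le_trans (leeD AA BB).
apply: le_trans (measureU2 _ _ _); last 2 first.
- by apply: measurableU; apply: measurableD.
- by apply: measurableU; apply: measurableD.
apply: le_measure; rewrite ?inE //.
- by apply: measurableU; apply: measurableD; exact: measurableU.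
- by apply: measurableU; apply: measurableU; exact: measurableD.
by move=> x; rewrite /setU /setD /=; tauto.
Qed.

Lemma approximable_bigcup (A : (set T)^nat) :
  (forall n, approximable (A n)) -> approximable (\bigcup_n A n).
Proof.
move=> aA; have mA n : measurable (A n) by case: (aA n).
have mUA : measurable (\bigcup_n A n) by exact: bigcup_measurable.
split=> // e e0; have e2 : 0 < e / 2 by rewrite divr_gt0.
pose D M := \bigcup_n A n `\` \big[setU/set0]_(i < M) A i.
have mU M : measurable (\big[setU/set0]_(i < M) A i) by exact: bigsetU_measurable.
have mD M : measurable (D M) by exact: measurableD.
have D0 : \bigcap_M D M = set0.
  apply/seteqP; split=> // x Dx; have [[i _ Ax] _] := Dx 0%N I.
  have [_] := Dx i.+1 I; apply; rewrite big_ord_recr; by right.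
have [M DM] : exists M, (rho (D M) <= (e / 2)%:E)%E.
  have /fine_cvgP[_] : rho \o D @ \oo --> 0%:E.
    rewrite -[0%:E](measure0 rho) -D0; apply: nonincreasing_cvg_mu => //.
    - by apply: le_lt_trans rho_fin; apply: le_measure; rewrite ?inE.
    - by rewrite D0.
    - apply/nonincreasing_seqP => M; apply/subsetPset => x [Ax nx]; split=> // h.
      by apply: nx; rewrite big_ord_recr; left.
  move=> /cvgrPdist_le/(_ _ e2)[M _ /(_ M (leqnn M))] /=.
  rewrite sub0r normrN => h; exists M; rewrite -[rho _]fineK ?lee_fin.
    exact: le_trans (ler_norm _) h.
  rewrite ge0_fin_numE ?measure_ge0 //.
  by apply: le_lt_trans rho_fin; apply: le_measure; rewrite ?inE.
have [_ /(_ _ e2)[B GB AB]] : approximable (\big[setU/set0]_(i < M) A i).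
  elim: M {DM} => [|M IH]; first by rewrite big_ord0; exact: approximable_base.
  by rewrite big_ord_recr; exact: approximableU.
have mB := Gm GB.
exists B => //; rewrite [e]splitr EFinD; apply: le_trans (leeD DM AB).
apply: le_trans (measureU2 _ _ _) => //; last first.
  by apply: measurableU; apply: measurableD.
apply: le_measure; rewrite ?inE //.
- by apply: measurableU; apply: measurableD.
- by apply: measurableU => //; apply: measurableU; exact: measurableD.
move=> x [[Ax nB]|[Bx nA]].
  by have [Ux|nU] := pselect ((\big[setU/set0]_(i < M) A i) x); [right; left|left].
right; right; split=> //; rewrite -bigcup_mkord => -[i _ Ai]; apply: nA; by exists i.
Qed.

Lemma sigma_approximable A : <<s G >> A -> approximable A.
Proof.
apply; split; last exact: approximable_base.
split; first exact: approximable_base.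
- by move=> B; rewrite setTD; exact: approximableC.
- exact: approximable_bigcup.
Qed.

End ApproximationByAlgebra.

(** A set [B] of the algebra approximates [A] for the sum of [mu] and [la], hence for both at once,
    and the inequality for [B] passes to [A]. *)
Lemma le_measure_algebra d (T : measurableType d) (R : realType)
    (mu la : {measure set T -> \bar R}) (G : set (set T)) (C : R) :
  (mu setT < +oo)%E -> (la setT < +oo)%E -> 0 <= C ->
  G set0 -> G `<=` measurable -> (forall A, G A -> G (~` A)) ->
  (forall A B, G A -> G B -> G (A `|` B)) ->
  (forall A, G A -> (la A <= C%:E * mu A)%E) ->
  forall A, <<s G >> A -> (la A <= C%:E * mu A)%E.
Proof.
move=> mufin lafin C0 G0 Gm GC GU Gle A GA.
pose rho : {measure set T -> \bar R} := measure_add mu la.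
have rfin : (rho setT < +oo)%E by rewrite [rho _]measure_addE lte_add_pinfty.
have [mA aA] := sigma_approximable rfin G0 Gm GC GU GA.
apply/lee_addgt0Pr => e e0.
(* On the symmetric difference the error is at most C times [mu] plus [la], hence at most C + 1
   times their sum. *)
have e1 : 0 < e / (C + 1) by rewrite divr_gt0 // ltr_wpDl.
have [B GB] := aA _ e1; have mB := Gm _ GB.
rewrite [rho _]measure_addE => ABe.
set X := (A `\` B) `|` (B `\` A) in ABe.
have mX : measurable X by apply: measurableU; apply: measurableD.
have laA : (la A <= la B + la X)%E.
  apply: le_trans (measureU2 _ mB mX); apply: le_measure; rewrite ?inE //.
    exact: measurableU.
  by move=> x Ax; have [Bx|nBx] := pselect (B x); [left|right; left].
have muB : (mu B <= mu A + mu X)%E.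
  apply: le_trans (measureU2 _ mA mX); apply: le_measure; rewrite ?inE //.
    exact: measurableU.
  by move=> x Bx; have [Ax|nAx] := pselect (A x); [left|right; right].
apply: le_trans laA _; apply: le_trans (leeD (Gle _ GB) (lexx _)) _.
apply: (@le_trans _ _ (C%:E * (mu A + mu X) + la X)%E).
  by rewrite leeD2r // lee_pmul // ?measure_ge0 // lee_fin.
rewrite muleDr ?ge0_adde_def ?inE ?measure_ge0 // -addeA leeD2l //.
apply: (@le_trans _ _ ((C + 1)%:E * (mu X + la X))%E).
  rewrite muleDr ?ge0_adde_def ?inE ?measure_ge0 // leeD //.
    by rewrite lee_wpmul2r ?measure_ge0 // lee_fin lerDl.
  by rewrite -[leLHS]mul1e lee_wpmul2r ?measure_ge0 // lee_fin lerDr.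
apply: le_trans (lee_wpmul2l _ ABe) _; first by rewrite lee_fin addr_ge0.
by rewrite -EFinM lee_fin mulrC divfK // gt_eqF // ltr_wpDl.
Qed.

Lemma open_measurable_borel (T : ptopologicalType) (U : set T) :
  open U -> measurable (U : set (borel T)).
Proof. exact: sub_sigma_algebra. Qed.

Lemma continuous_measurable_borel (S T : ptopologicalType) (f : S -> T) :
  continuous f -> measurable_fun setT (f : borel S -> borel T).
Proof.
move=> cf; apply: (@measurability _ _ (borel S) (borel T) setT f (@open T)) => //.
move=> _ [U oU <-]; rewrite setTI; apply: open_measurable_borel.
by apply: open_comp => // x _; exact: cf.
Qed.

Lemma pushforward_measure d d' (T1 : measurableType d) (T2 : measurableType d')
    (R : realType) (m : {measure set T1 -> \bar R}) (f : T1 -> T2) :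
  measurable_fun setT f ->
  exists m' : {measure set T2 -> \bar R}, forall A, m' A = m (f @^-1` A).
Proof.
move=> mf; unshelve eexists.
  unshelve refine (pushforward m f : {measure set T2 -> \bar R}); exact: mf.
by [].
Qed.

(** * Translation invariant measures of the cosets *)

Section LevelMeasure.
Context (R : realType) (k : finFieldType) (m n : nat).
Local Notation V := 'M[laurent k]_(m, n).
Variable mu : {measure set (borel V) -> \bar R}.

Definition translation_invariant (nu : set (borel V) -> \bar R) :=
  forall (v : V) (A : set V), measurable (A : set (borel V)) ->
    nu [set v + x | x in A] = nu A.

Hypothesis mu_inv : translation_invariant mu.

Lemma level_measurable N (S : {set 'M[tring k N]_(m, n)}) :
  measurable (level S : set (borel V)).
Proof. by apply: open_measurable_borel; exact: level_open. Qed.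

Lemma lattice_measurable : measurable (@lattice k m n : set (borel V)).
Proof. by apply: open_measurable_borel; exact: lattice_open. Qed.

(** The coset of [s] is the translate of the coset of 0 by a lift of [s]. *)
Lemma measure_level1 N (s : 'M[tring k N]_(m, n)) :
  mu (level [set s]) = mu (level [set 0%R : 'M[tring k N]_(m, n)]).
Proof.
rewrite -[RHS](mu_inv (emb (map_mx (@lift_red k N) s)) (level_measurable _)); congr (mu _).
apply/seteqP; split=> [_ [h + <-]|_ [_ [h + <-] <-]]; rewrite /= !inE => /eqP hs.
  exists (emb (h - map_mx (@lift_red k N) s)); last by rewrite -embD subrKC.
  by apply/level_emb; rewrite inE map_mxB hs map_lift_redK subrr.
by rewrite -embD; apply/level_emb; rewrite inE map_mxD hs map_lift_redK addr0.
Qed.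

Lemma measure_level N (S : {set 'M[tring k N]_(m, n)}) :
  mu (level S) = (#|S|%:R%:E * mu (level [set 0%R : 'M[tring k N]_(m, n)]))%E.
Proof.
have [M] := ubnP #|S|; elim: M S => // M IH S SM.
have [->|[s sS]] := finset.set_0Vmem S.
  rewrite cards0 mul0e (_ : level _ = set0) ?measure0 //.
  by apply/seteqP; split=> // x [h]; rewrite /= inE.
rewrite -(finset.setD1K sS) (_ : level _ = level [set s] `|` level (S :\ s)); last first.
  apply/seteqP; split=> [_ [h + <-]|_ [[h + <-]|[h + <-]]]; rewrite /= !inE.
  - by move=> /orP[hs|hS]; [left|right]; exists h; rewrite //= !inE.
  - by move=> hs; exists h; rewrite //= !inE hs.
  - by move=> hs; exists h; rewrite //= !inE hs orbT.
rewrite measureU; [|exact: level_measurable|exact: level_measurable|]; last first.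
  apply/seteqP; split=> // _ [[h + <-]]; rewrite /= inE => /eqP hs /level_emb.
  by rewrite hs !inE eqxx.
have cS : #|S| = #|S :\ s|.+1 by rewrite (cardsD1 s) sS.
have SsM : (#|S :\ s| < M)%N by rewrite cS ltnS in SM.
apply: etrans (f_equal2 (@adde R) (measure_level1 s) (IH _ SsM)) _.
rewrite cardsU1 !inE eqxx /= add1n -[in RHS]addn1 natrD EFinD.
by rewrite ge0_muleDl ?lee_fin // mul1e addeC.
Qed.

Lemma measure_lattice N :
  mu (@lattice k m n) = ((#|tring k N| ^ (m * n))%:R%:E *
    mu (level [set 0%R : 'M[tring k N]_(m, n)]))%E.
Proof. by rewrite -(level_setT k m n N) measure_level cardsT card_mx. Qed.

End LevelMeasure.

(** * Domination of the pushforward of the lattice *)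

Section Domination.
Context (R : realType) (k : finFieldType) (n : nat).
Local Notation V := 'M[laurent k]_n.+1.
Local Notation W := 'rV[laurent k]_n.+1.
Variables (mu : {measure set (borel W) -> \bar R}).
Variables (nu : {measure set (borel V) -> \bar R}).
Hypotheses (mu_inv : translation_invariant mu) (nu_inv : translation_invariant nu).
Hypotheses (mu_fin : (mu (@lattice k 1 n.+1) < +oo)%E).
Hypotheses (mu_pos : (0 < mu (@lattice k 1 n.+1))%E).
Hypotheses (nu_fin : (nu (@lattice k n.+1 n.+1) < +oo)%E).
Local Notation p := (@chevalley (laurent k) n.+1).

Lemma chevalley_measurable : measurable_fun setT (p : borel V -> borel W).
Proof. by apply: continuous_measurable_borel; exact: chevalley_continuous. Qed.

Let preimage_level N (S : {set 'rV[tring k N]_n.+1}) :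
  p @^-1` level S `&` @lattice k n.+1 n.+1 =
  level [set x : 'M[tring k N]_n.+1 | chevalley x \in S].
Proof.
apply/seteqP; split=> [x [+ [h _ xE]]|_ [h + <-]].
  rewrite -xE /preimage /= chevalley_emb => /level_emb.
  by rewrite -chevalley_red => hS; exists h; rewrite //= inE.
rewrite /= inE chevalley_red => hS; split; last by exists h.
by rewrite /preimage /= chevalley_emb; apply/level_emb.
Qed.

(** The constant of the finite count times the ratio of the masses of the two lattices. *)
Let C : R := ((n.+1 * n.+2) ^ n)%:R * fine (nu (@lattice k n.+1 n.+1)) /
  fine (mu (@lattice k 1 n.+1)).

(** With Q elements in the residue ring, the lattice has Q^((n+1)^2) times the mass of a coset for
    [nu] and Q^(n+1) times for [mu]. The factor Q^(n(n+1)) of [card_chevalley_fibre] compensates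
    exactly, so the constant does not depend on N. *)
Let le_level N (S : {set 'rV[tring k N]_n.+1}) :
  (nu (p @^-1` level S `&` @lattice k n.+1 n.+1) <= C%:E * mu (level S))%E.
Proof.
rewrite preimage_level (measure_level nu_inv) (measure_level mu_inv S).
pose Q := #|tring k N|; have Q0 : (0 < Q%:R :> R)%R.
  by rewrite ltr0n; apply/card_gt0P; exists 0.
have [nuL muL] := (measure_lattice nu_inv N, measure_lattice mu_inv N).
rewrite -/Q mul1n in muL; rewrite -/Q in nuL.
set a := nu (level _) in nuL *; set b := mu (level _) in muL *.
have QX e : (0 < (Q ^ e)%:R :> R)%R by rewrite natrX exprn_gt0.
have afin : a \is a fin_num.
  rewrite ge0_fin_numE ?measure_ge0 //; apply: le_lt_trans nu_fin.
  rewrite nuL -[leLHS]mul1e lee_wpmul2r ?measure_ge0 // lee_fin.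
  by rewrite ler1n expn_gt0; apply/orP; left; rewrite -(ltr0n R).
have bfin : b \is a fin_num.
  rewrite ge0_fin_numE ?measure_ge0 //; apply: le_lt_trans mu_fin.
  rewrite muL -[leLHS]mul1e lee_wpmul2r ?measure_ge0 // lee_fin.
  by rewrite ler1n expn_gt0; apply/orP; left; rewrite -(ltr0n R).
rewrite /C nuL muL -(fineK afin) -(fineK bfin) -!EFinM lee_fin /=.
have b0 : 0 < fine b.
  move: mu_pos; rewrite muL -(fineK bfin) -EFinM lte_fin.
  by rewrite pmulr_rgt0.
have a0 : 0 <= fine a by rewrite fine_ge0 // measure_ge0.
have -> : ((n.+1 * n.+2) ^ n)%:R * ((Q ^ (n.+1 * n.+1))%:R * fine a) /
    ((Q ^ n.+1)%:R * fine b) * (#|S|%:R * fine b) =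
    (#|S| * ((n.+1 * n.+2) ^ n * Q ^ (n * n.+1)))%:R * fine a :> R.
  have -> : (n.+1 * n.+1 = n * n.+1 + n.+1)%N by rewrite mulSn addnC.
  rewrite expnD !natrM; field.
  by rewrite !gt_eqF.
by rewrite ler_wpM2r // ler_nat card_chevalley_fibre.
Qed.

(** [le_level] gives the inequality on unions of cosets, and [le_measure_algebra] extends it to
    Borel sets. *)
Lemma lattice_domination : exists2 C : R, 0 <= C &
  forall B : set W, measurable (B : set (borel W)) ->
    (nu (p @^-1` B `&` @lattice k n.+1 n.+1) <=
     C%:E * mu (B `&` @lattice k 1 n.+1))%E.
Proof.
have C0 : 0 <= C.
  by rewrite divr_ge0 ?mulr_ge0 ?fine_ge0 ?measure_ge0.
exists C => // B mB.
have mV := @lattice_measurable k n.+1 n.+1; have mW := @lattice_measurable k 1 n.+1.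
have [la laE] := pushforward_measure (mrestr nu mV) chevalley_measurable.
have pW : p @^-1` @lattice k 1 n.+1 `&` @lattice k n.+1 n.+1 = @lattice k n.+1 n.+1.
  apply/seteqP; split=> [x []//|_ [h _ <-]]; split; last by exists h.
  by rewrite /preimage /= chevalley_emb; exists (chevalley h).
(* Only the trace on the lattice is a union of cosets, so that [G] is stable under complement in the
   whole space. *)
pose G : set (set (borel W)) := [set A : set W | measurable (A : set (borel W)) /\
  exists N (S : {set 'rV[tring k N]_n.+1}), A `&` @lattice k 1 n.+1 = level S].
have level0 : level (finset.set0 : {set 'rV[tring k 0]_n.+1}) = set0.
  by apply/seteqP; split=> // x [h]; rewrite /= inE.
have -> : (nu (p @^-1` B `&` @lattice k n.+1 n.+1) = la B)%E by rewrite laE.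
apply: (@le_measure_algebra _ _ _ (mrestr mu mW) la G C) => //.
- by rewrite [X in (X < _)%E](_ : _ = mu (@lattice k 1 n.+1)) //; congr (mu _); exact: setTI.
- rewrite laE [X in (X < _)%E](_ : _ = nu (@lattice k n.+1 n.+1)) //.
  by congr (nu _); exact: setTI.
- by split; [exact: measurable0|exists 0%N, finset.set0; rewrite set0I level0].
- by move=> A [].
- move=> A [mA [N [S AS]]]; split; first exact: measurableC.
  exists N, (finset.setC S); apply/seteqP; split=> [x [nAx [h _ xh]]|_ [h + <-]].
    exists h => //; rewrite /= inE; apply/negP => hS; apply: nAx.
    have : level S x by exists h.
    by rewrite -AS => -[].
  rewrite /= inE => hS; split; last by exists h.
  move=> Ah; have : (A `&` @lattice k 1 n.+1) (emb h) by split => //; exists h.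
  by rewrite AS => /level_emb; apply/negP.
- move=> A A' [mA [N [S AS]]] [mA' [N' [S' AS']]]; split; first exact: measurableU.
  have [S1 S1E] := level_refine S (leq_maxl N N').
  have [S2 S2E] := level_refine S' (leq_maxr N N').
  exists (maxn N N'), (finset.setU S1 S2); rewrite setIUl AS AS' -S1E -S2E.
  apply/seteqP; split=> [x [[h hS xh]|[h hS xh]]|_ [h + <-]].
  - by exists h => //; rewrite /= inE hS.
  - by exists h => //; rewrite /= inE hS orbT.
  - by rewrite /= inE => /orP[hS|hS]; [left|right]; exists h.
- move=> A [mA [N [S AS]]]; rewrite laE /= /mrestr AS.
  rewrite (_ : p @^-1` A `&` _ = p @^-1` level S `&` @lattice k n.+1 n.+1) ?le_level //.
  by rewrite -AS preimage_setI -setIA pW.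
- move: B mB; apply: smallest_sub; first exact: smallest_sigma_algebra.
  move=> U oU.
  (* An open set is a countable union of members of [G]: its part outside the lattice, of empty
     trace, and the cosets it contains. *)
  have -> : U = \bigcup_i (if i is N.+1 then level (sub_level N U)
      else U `\` @lattice k 1 n.+1).
    rewrite -[LHS](setUIDK U (@lattice k 1 n.+1)) bigcup_sub_level //.
    apply/seteqP; split=> [x [[N _ xN]|nx]|x [[|N] _ xN]].
    - by exists N.+1.
    - by exists 0%N.
    - by right.
    - by left; exists N.
  apply: sigma_algebra_bigcup => -[|N]; apply: sub_sigma_algebra; split.
  + by apply: measurableD => //; exact: open_measurable_borel.
  + by exists 0%N, finset.set0; rewrite setDE -setIA setICl setI0 level0.
  + exact: level_measurable.
  + exists N, (sub_level N U); apply/setIidPl => _ [h _ <-]; by exists h.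
Qed.

End Domination.

(** * Rescaling of invariant measures, and passage from the lattice to the whole space *)

Section Rescaling.
Context (R : realType) (k : finFieldType) (m n : nat).
Local Notation V := 'M[laurent k]_(m, n).
Implicit Types (a : V) (mu : {measure set (borel V) -> \bar R}).

Definition hadamard_inv a : V := \matrix_(i, j) (a i j)^-1.

Lemma hadamard_invK a : (forall i j, a i j != 0) ->
  cancel (hadamard a) (hadamard (hadamard_inv a)).
Proof. by move=> a0 x; apply/matrixP => i j; rewrite !mxE mulKf. Qed.

Lemma hadamard_invKV a : (forall i j, a i j != 0) ->
  cancel (hadamard (hadamard_inv a)) (hadamard a).
Proof. by move=> a0 x; apply/matrixP => i j; rewrite !mxE mulVKf. Qed.

Lemma hadamard_measurable a : measurable_fun setT (hadamard a : borel V -> borel V).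
Proof. by apply: continuous_measurable_borel; exact: hadamard_continuous. Qed.

Lemma measurable_preimage_hadamard a (A : set V) : measurable (A : set (borel V)) ->
  measurable (hadamard a @^-1` A : set (borel V)).
Proof. by move=> mA; rewrite -[X in measurable X]setTI; exact: hadamard_measurable. Qed.

(** Invariance survives because [hadamard a] is an additive bijection. *)
Lemma rescaled_measure a mu : (forall i j, a i j != 0) -> translation_invariant mu ->
  exists2 mu' : {measure set (borel V) -> \bar R}, translation_invariant mu' &
    forall A, mu' A = mu (hadamard a @^-1` A).
Proof.
move=> a0 mu_inv; have [mu' mu'E] := pushforward_measure mu (hadamard_measurable a).
exists mu' => // v A mA; rewrite !mu'E -[RHS](mu_inv (hadamard (hadamard_inv a) v));
  last exact: measurable_preimage_hadamard.
congr (mu _); apply/seteqP; split=> [x [y Ay yx]|_ [x Ax <-]].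
  exists (hadamard (hadamard_inv a) y); first by rewrite /preimage /= hadamard_invKV.
  by apply: (can_inj (hadamard_invK a0)); rewrite hadamardD !hadamard_invKV.
by rewrite /preimage /= hadamardD hadamard_invKV //; exists (hadamard a x).
Qed.

(** This preimage is the image of the compact lattice under the inverse scaling. *)
Lemma lattice_fin mu a : haar_measure mu -> (forall i j, a i j != 0) ->
  (mu (hadamard a @^-1` @lattice k m n) < +oo)%E.
Proof.
move=> [_ mu_cpt _] a0.
rewrite (_ : hadamard a @^-1` _ = hadamard (hadamard_inv a) @` @lattice k m n).
  apply: mu_cpt; apply: continuous_compact; last exact: lattice_compact.
  by apply: continuous_subspaceT => x; exact: hadamard_continuous.
apply/seteqP; split=> [x Lx|_ [x Lx <-]].
  by exists (hadamard a x) => //; exact: hadamard_invK.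
by rewrite /preimage /= hadamard_invKV.
Qed.

Lemma const_mx_tpow_neq0 M (i : 'I_m) (j : 'I_n) : const_mx (tpow k M) i j != 0.
Proof. by rewrite mxE tpow_neq0. Qed.

(** The exponent is a successor in order to match the residues modulo t^(M+1) used by [level]. *)
Lemma scale_mx_decomp (x : V) : exists M, lattice (scale_mx M.+1 x).
Proof.
have [M [h xh]] := mx_decomp x; exists M; exists (fps_t k *: h) => //.
apply/matrixP => i j; rewrite !mxE; have /matrixP/(_ i j) := xh.
by rewrite !mxE /tpow exprS !tofracM -mulrA => ->.
Qed.

(* If the lattice L is negligible, so is its rescaling t^(-M) L, a finite union
   of translates of L; these sets cover the whole space. *)
Lemma lattice_gt0 mu : translation_invariant mu -> mu setT <> 0%E ->
  (0 < mu (@lattice k m n))%E.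
Proof.
move=> mu_inv mu0; rewrite lt0e measure_ge0 andbT; apply/eqP => L0.
pose D M := @scale_mx k m n M.+1 @^-1` @lattice k m n.
have mD M : measurable (D M : set (borel V)).
  by apply: measurable_preimage_hadamard; exact: lattice_measurable.
have D0 M : mu (D M) = 0%E.
  have [mu' mu'_inv mu'E] := rescaled_measure (@const_mx_tpow_neq0 M.+1) mu_inv.
  (* For [mu'] the lattice is a finite union of cosets of equal mass, and the coset of 0 modulo
     t^(M+1) pulls back to the lattice itself. *)
  rewrite -[LHS]mu'E (measure_lattice mu'_inv M) mu'E.
  rewrite (_ : hadamard _ @^-1` _ = @lattice k m n) ?L0 ?mule0 //.
  apply/seteqP; split=> [x [h + xh]|_ [h _ <-]]; last first.
    exists (fps_t k ^+ M.+1 *: h).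
      rewrite /= inE; apply/eqP; rewrite -[RHS](raddf0 (map_mx (@red k M))).
      by apply/map_red_eqP; exists h; rewrite add0r.
    by apply/matrixP => i j; rewrite !mxE /tpow tofracM.
  rewrite /= inE => /eqP h0.
  have [|d hd] := (@map_red_eqP k m n M h 0).1.
    by rewrite h0; apply/esym; exact: (raddf0 (map_mx (@red k M))).
  exists d => //; apply: (can_inj (hadamard_invK (@const_mx_tpow_neq0 M.+1))).
  rewrite -xh hd add0r; apply/matrixP => i j; rewrite !mxE /tpow -tofracM //.
apply: mu0; apply/eqP; rewrite eq_le measure_ge0 andbT.
have DT : [set: borel V] `<=` \bigcup_M (D M : set (borel V)).
  by move=> x _; have [M xM] := scale_mx_decomp x; exists M.
apply: le_trans (@measure_sigma_subadditive _ _ _ mu _ D mD measurableT DT) _.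
by rewrite eseries0.
Qed.

End Rescaling.

(** Scaling matrices by t^M scales the coefficients by [s], so [lattice_domination] applies to the
    measures pushed forward by these two scalings. [K] is the set that [s] sends into the
    lattice. *)
Lemma haar_domination (R : realType) (k : finFieldType) n
    (mu : {measure set (borel 'rV[laurent k]_n.+1) -> \bar R})
    (nu : {measure set (borel 'M[laurent k]_n.+1) -> \bar R}) M :
  haar_measure mu -> haar_measure nu ->
  exists C : R, exists K : set 'rV[laurent k]_n.+1,
    [/\ 0 <= C, measurable (K : set (borel _)), (mu K < +oo)%E &
      forall B : set 'rV[laurent k]_n.+1, measurable (B : set (borel _)) ->
        (nu (@chevalley (laurent k) n.+1 @^-1` B `&`
             @scale_mx k n.+1 n.+1 M @^-1` @lattice k n.+1 n.+1) <=
         C%:E * mu (B `&` K))%E].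
Proof.
move=> hmu hnu; have [mu_inv _ mu0] := hmu; have [nu_inv _ _] := hnu.
pose s : 'rV[laurent k]_n.+1 := \row_j tpow k M ^+ (n.+1 - j).
have s0 i j : s i j != 0 by rewrite mxE expf_neq0 // tpow_neq0.
have [mu' mu'_inv mu'E] := rescaled_measure s0 mu_inv.
have [nu' nu'_inv nu'E] := rescaled_measure (@const_mx_tpow_neq0 k n.+1 n.+1 M) nu_inv.
have mu'fin : (mu' (@lattice k 1 n.+1) < +oo)%E by rewrite mu'E; exact: lattice_fin.
have nu'fin : (nu' (@lattice k n.+1 n.+1) < +oo)%E.
  by rewrite nu'E; apply: lattice_fin => //; exact: const_mx_tpow_neq0.
have mu'pos : (0 < mu' (@lattice k 1 n.+1))%E.
  by apply: lattice_gt0 => //; rewrite mu'E preimage_setT.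
have [C C0 CP] := lattice_domination mu'_inv nu'_inv mu'fin mu'pos nu'fin.
exists C, (hadamard s @^-1` @lattice k 1 n.+1); split => //.
- by apply: measurable_preimage_hadamard; exact: lattice_measurable.
- exact: lattice_fin.
move=> B mB.
(* [B] is replaced by its image under [s], written as a preimage under the inverse; pulling back by
   [s] restores [B]. *)
have := CP (hadamard (hadamard_inv s) @^-1` B) (measurable_preimage_hadamard _ mB).
rewrite mu'E nu'E.
have sE x : hadamard (hadamard_inv s) (chevalley (hadamard (const_mx (tpow k M)) x)) =
    chevalley x.
  by rewrite [chevalley _]chevalley_scale; exact: hadamard_invK.
congr (nu _ <= C%:E * mu _)%E; apply/seteqP; split=> x.
- by move=> [Bx Lx]; split => //; rewrite /preimage /= in Bx *; rewrite sE in Bx.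
- by move=> [Bx Lx]; split => //; rewrite /preimage /= in Bx *; rewrite sE.
- by move=> [Bx Lx]; split => //; rewrite /preimage /= hadamard_invK in Bx.
- by move=> [Bx Lx]; split => //; rewrite /preimage /= hadamard_invK.
Qed.

(** * The density *)

Section BoundedDensity.
Context d (T : measurableType d) (R : realType).

(** On the set where g > h the difference is positive and has integral at most 0, so this set is
    negligible. *)
Lemma ae_le_of_integral_le (mu : {measure set T -> \bar R}) (g h : T -> R) :
  mu.-integrable setT (EFin \o g) -> mu.-integrable setT (EFin \o h) ->
  (forall A, measurable A ->
    (\int[mu]_(x in A) (g x)%:E <= \int[mu]_(x in A) (h x)%:E)%E) ->
  {ae mu, forall x, g x <= h x}.
Proof.
move=> ig ih gh.
have mg : measurable_fun setT g by apply/measurable_EFinP; exact: measurable_int ig.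
have mh : measurable_fun setT h by apply/measurable_EFinP; exact: measurable_int ih.
pose A := [set x | 0 < g x - h x].
have mA : measurable A.
  have := measurable_funB mg mh measurableT (measurable_itv `]0, +oo[).
  rewrite setTI; congr measurable; apply/seteqP; split=> x /=;
  by rewrite in_itv /= andbT.
have igA : mu.-integrable A (EFin \o g) by exact: integrableS ig.
have ihA : mu.-integrable A (EFin \o h) by exact: integrableS ih.
have mgh : measurable_fun A (EFin \o (g \- h)).
  by apply/measurable_EFinP; apply: measurable_funTS; exact: measurable_funB.
have I0 : (\int[mu]_(x in A) `|(EFin \o (g \- h)%R) x| = 0)%E.
  rewrite (eq_integral (fun x => ((EFin \o g) \- (EFin \o h)) x))%E; last first.
    by move=> x; rewrite inE /A /= => gx; rewrite ger0_norm // ltW.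
  apply/eqP; rewrite eq_le; apply/andP; split; last first.
    apply: integral_ge0 => x; rewrite /A /= => gx.
    by rewrite -EFinB lee_fin ltW.
  rewrite integralB //; have := gh A mA.
  by rewrite -sube_le0 ?fin_numE; rewrite ?sube_le0 //.
move/(ae_eq_integral_abs mu mA mgh) : I0; apply: filterS => x xA.
rewrite leNgt; apply/negP; rewrite -subr_gt0 => xgh.
by have := xA xgh; rewrite /= => -[] gh0; rewrite gh0 ltxx in xgh.
Qed.

Lemma integrable_indicZ (mu : {measure set T -> \bar R}) (K : set T) (C : R) :
  measurable K -> (mu K < +oo)%E -> 0 <= C ->
  mu.-integrable setT (EFin \o (fun x => C * \1_K x)) /\
  forall A, measurable A ->
    (\int[mu]_(x in A) (C * \1_K x)%:E = C%:E * mu (A `&` K))%E.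
Proof.
move=> mK muK C0.
have IA A : measurable A -> (\int[mu]_(x in A) (C * \1_K x)%:E = C%:E * mu (A `&` K))%E.
  move=> mA; under eq_integral do rewrite EFinM.
  rewrite ge0_integralZl_EFin //.
  - by rewrite integral_indic // setIC.
  - by apply/measurable_EFinP; exact: measurable_indic.
split => //; apply/integrableP; split.
  by apply/measurable_EFinP; apply: measurable_funM => //; exact: measurable_indic.
rewrite (eq_integral (fun x => (C * \1_K x)%:E)); last first.
  by move=> x _; rewrite /= ger0_norm // mulr_ge0.
by rewrite IA // setTI lte_mul_pinfty // lee_fin.
Qed.

(** The inequality on all measurable sets bounds the Radon-Nikodym derivative from both sides,
    almost everywhere, by C times the indicator of [K]. *)
Lemma bounded_density (mu : {sigma_finite_measure set T -> \bar R})
    (la : {charge set T -> \bar R}) (K : set T) (C : R) :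
  measurable K -> (mu K < +oo)%E -> 0 <= C ->
  (forall A, measurable A -> (`|la A| <= C%:E * mu (A `&` K))%E) ->
  exists f : T -> R, [/\ measurable_fun setT f,
    mu.-integrable setT (EFin \o f),
    forall x, `|f x| <= C * \1_K x &
    forall A, measurable A -> la A = (\int[mu]_(x in A) (f x)%:E)%E].
Proof.
move=> mK muK C0 laC.
have dom : la `<< mu.
  apply/null_content_dominatesP => A mA muA0; apply/eqP.
  rewrite -abse_eq0 eq_le abse_ge0 andbT; apply: le_trans (laC _ mA) _.
  rewrite (@subset_measure0 _ _ _ mu (A `&` K) A) ?mule0 //.
  exact: measurableI.
pose g x := fine (Radon_Nikodym la mu x).
have gE : EFin \o g = Radon_Nikodym la mu.
  by apply/funext => x /=; rewrite fineK //; exact: Radon_Nikodym_fin_num.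
have ig : mu.-integrable setT (EFin \o g).
  by rewrite gE; exact: Radon_Nikodym_integrable.
have laE A : measurable A -> la A = (\int[mu]_(x in A) (g x)%:E)%E.
  move=> mA; rewrite (Radon_Nikodym_integral dom mA); apply: eq_integral => x _.
  by rewrite -gE.
have [iK IK] := integrable_indicZ mK muK C0.
have up : {ae mu, forall x, g x <= C * \1_K x}.
  apply: ae_le_of_integral_le => // A mA; rewrite -laE // IK //.
  exact: le_trans (lee_abs _) (laC _ mA).
have lo : {ae mu, forall x, - (C * \1_K x) <= g x}.
  have iN : mu.-integrable setT (EFin \o (fun x => - (C * \1_K x))).
    rewrite (_ : EFin \o _ = -%E \o (EFin \o (fun x => C * \1_K x))); last exact/funext.
    exact: integrableN.
  apply: ae_le_of_integral_le => // A mA; rewrite -laE //.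
  under eq_integral do rewrite EFinN.
  rewrite integralN; last first.
    by apply: integrable_add_def => //; exact: (integrableS measurableT mA (@subsetT _ A) iK).
  rewrite IK // leeNl; apply: le_trans (laC _ mA).
  by rewrite -abseN; exact: lee_abs.
(* Setting the derivative to 0 outside [S] makes the bounds hold everywhere and changes no
   integral. *)
pose S := [set x | - (C * \1_K x) <= g x <= C * \1_K x].
have mg : measurable_fun setT g by apply/measurable_EFinP; exact: measurable_int ig.
have mCK : measurable_fun setT (fun x => C * \1_K x).
  by apply/measurable_EFinP; exact: measurable_int iK.
have mS : measurable S.
  rewrite (_ : S = [set x | - (C * \1_K x) <= g x] `&` [set x | g x <= C * \1_K x]).
    apply: measurableI; rewrite -[X in measurable X]setTI.
      by apply: measurable_fun_le => //; exact: measurableT_comp.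
    exact: measurable_fun_le.
  by apply/seteqP; split=> x /= => [/andP[]|[? ?]] //; apply/andP.
pose f x := g x * \1_S x.
have mf : measurable_fun setT f.
  by apply: measurable_funM => //; exact: measurable_indic.
have fg A : measurable A -> (\int[mu]_(x in A) (f x)%:E = \int[mu]_(x in A) (g x)%:E)%E.
  move=> mA; apply: ae_eq_integral => //.
  - by apply/measurable_EFinP; exact: measurable_funTS.
  - by apply/measurable_EFinP; exact: measurable_funTS.
  apply: filterS2 up lo => x ux lx _.
  by rewrite /f indicE mem_set ?mulr1 //; apply/andP.
have fC x : `|f x| <= C * \1_K x.
  rewrite /f indicE; case: (boolP (x \in S)) => [|_].
    by rewrite inE mulr1 ler_norml.
  by rewrite mulr0 normr0 mulr_ge0.
exists f; split => //.
- apply: le_integrable iK => //; first exact/measurable_EFinP.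
  move=> x _ /=; rewrite lee_fin; apply: le_trans (fC x) _; exact: ler_norm.
- by move=> A mA; rewrite fg // laE.
Qed.

End BoundedDensity.

(** This puts sigma-finiteness into the type of the measure, as [bounded_density] requires. *)
Lemma sigma_finite_measure_of d (T : measurableType d) (R : realType)
    (mu : {measure set T -> \bar R}) : sigma_finite setT mu ->
  exists mu' : {sigma_finite_measure set T -> \bar R}, forall A, mu' A = mu A.
Proof.
move=> sf; pose s1 := isSFinite.Build _ _ _ mu (sfinite_measure_sigma_finite sf).
pose s2 := isSigmaFinite.Build _ _ _ mu sf.
pose mu' : {sigma_finite_measure set T -> \bar R} :=
  HB.pack (mu : set T -> \bar R) (Measure.class mu) s1 s2.
by exists mu'.
Qed.

Lemma pushforward_induced_charge d d' (T1 : measurableType d) (T2 : measurableType d')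
    (R : realType) (m : {measure set T1 -> \bar R}) (g : T1 -> \bar R) (f : T1 -> T2) :
  m.-integrable setT g -> measurable_fun setT f ->
  exists la : {charge set T2 -> \bar R},
    forall A, la A = (\int[m]_(x in f @^-1` A) g x)%E.
Proof.
move=> ig mf; unshelve eexists.
  by unshelve refine (pushforward (induced_charge ig) f : {charge set T2 -> \bar R}).
by [].
Qed.

Lemma compact_nat_cover (T : ptopologicalType) (K : set T) (U : (set T)^nat) :
  compact K -> (forall i, open (U i)) -> nondecreasing_seq U ->
  K `<=` \bigcup_i U i -> exists N, K `<=` U N.
Proof.
rewrite compact_cover => cK oU ndU KU.
have [|E _ KE] := cK nat setT U (fun i _ => oU i); first exact: KU.
exists (\max_(i <- finmap.enum_fset E) i)%N => x /KE[i iE Ux].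
suff /ndU/subsetPset : (i <= \max_(i <- finmap.enum_fset E) i)%N by apply.
exact: leq_bigmax_seq.
Qed.

(** * Pushforward of a compactly supported, locally constant real density *)

Section Density.
Context (R : realType) (k : finFieldType) (n : nat).
Local Notation F := (laurent k).
Local Notation V := 'M[F]_n.+1.
Local Notation W := 'rV[F]_n.+1.
Local Notation p := (@chevalley F n.+1).
Variables (mu : {measure set (borel W) -> \bar R}) (nu : {measure set (borel V) -> \bar R}).
Hypotheses (hmu : haar_measure mu) (hnu : haar_measure nu).

(** These are the lattices t^(-M) L, which increase and exhaust the space. *)
Let D M : set V := @scale_mx k n.+1 n.+1 M @^-1` @lattice k n.+1 n.+1.

Let D_nd : nondecreasing_seq D.
Proof.
apply/nondecreasing_seqP => M; apply/subsetPset => x [h _ xh].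
exists (fps_t k *: h) => //; apply/matrixP => i j.
have /matrixP/(_ i j) := xh; rewrite !mxE /tpow exprS !tofracM => ->.
by rewrite mulrA.
Qed.

Lemma haar_sigma_finite : sigma_finite setT mu.
Proof.
exists (fun M => @scale_mx k 1 n.+1 M.+1 @^-1` @lattice k 1 n.+1).
  by apply/esym/seteqP; split=> // x _; have [M xM] := scale_mx_decomp x; exists M.
move=> M; split; first by apply: measurable_preimage_hadamard; exact: lattice_measurable.
by apply: lattice_fin => //; exact: const_mx_tpow_neq0.
Qed.

(** Since |phi| is at most M times the indicator of [D M], [haar_domination] bounds the pushforward
    on A by M C times [mu (A]&[K)], and [bounded_density] applies. *)
Lemma chevalley_pushforward_density (phi : V -> R) :
  (forall x, \forall y \near x, phi y = phi x) ->
  (exists2 K, compact K & forall x, ~ K x -> phi x = 0) ->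
  nu.-integrable setT (EFin \o (phi : borel V -> R)) ->
  exists f : borel W -> R, exists C : R, exists K : set (borel W),
    [/\ measurable_fun setT f, measurable K, (mu K < +oo)%E, 0 <= C &
    [/\ mu.-integrable setT (EFin \o f), forall x, `|f x| <= C * \1_K x &
      forall A : set (borel W), measurable A ->
        (\int[nu]_(x in p @^-1` A) (phi x)%:E = \int[mu]_(x in A) (f x)%:E)%E]].
Proof.
move=> lc [S cS S0] iphi.
(* By compactness a single M serves both as the index of a lattice containing the support and as a
   bound of |phi|. *)
have [M phiM] : exists M, S `<=` D M `&` [set x | `|phi x| < M%:R].
  apply: compact_nat_cover => // [M||x _].
  - apply: openI.
      by apply: open_comp; [move=> x _; exact: hadamard_continuous|exact: lattice_open].
    rewrite openE => x /= xM; apply: filterS (lc x) => y /= ->; exact: xM.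
  - move=> i j ij; apply/subsetPset => x [Dx xi]; split.
      by have /subsetPset := D_nd ij; apply.
    by apply: lt_le_trans xi _; rewrite ler_nat.
  have [M xM] := scale_mx_decomp x; exists (maxn M.+1 (Num.truncn `|phi x|).+1) => //; split.
    by have /subsetPset := D_nd (leq_maxl M.+1 (Num.truncn `|phi x|).+1); apply.
  rewrite /=; apply: lt_le_trans (_ : (Num.truncn `|phi x|).+1%:R <= _).
    exact: truncnS_gt.
  by rewrite ler_nat leq_maxr.
have phi_le x : `|phi x| <= M%:R * \1_(D M) x.
  have [/phiM[Dx xM]|/S0 ->] := pselect (S x).
    by rewrite indicE mem_set // mulr1 ltW.
  by rewrite normr0 mulr_ge0.
have [C [K [C0 mK muK dom]]] := haar_domination M hmu hnu.
have [la laE] := pushforward_induced_charge iphi (@chevalley_measurable k n).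
have mD : measurable (D M : set (borel V)).
  by apply: measurable_preimage_hadamard; exact: lattice_measurable.
have la_le A : measurable A -> (`|la A| <= (M%:R * C)%:E * mu (A `&` K))%E.
  move=> mA; rewrite laE.
  have mpA : measurable (p @^-1` A : set (borel V)).
    by rewrite -[X in measurable X]setTI; exact: chevalley_measurable.
  have mphi : measurable_fun (p @^-1` A : set (borel V)) (EFin \o (phi : borel V -> R)).
    by apply: measurable_funTS; exact: measurable_int iphi.
  apply: le_trans (le_abse_integral _ mpA mphi) _.
  apply: (@le_trans _ _ (\int[nu]_(x in p @^-1` A) (M%:R * \1_(D M) x)%:E)%E).
    apply: ge0_le_integral => //.
    - exact: measurableT_comp.
    - by apply/measurable_EFinP; apply: measurable_funM => //; exact: measurable_indic.
    - by move=> x _; rewrite /= lee_fin.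
  under eq_integral do rewrite EFinM.
  rewrite ge0_integralZl_EFin //; last by apply/measurable_EFinP; exact: measurable_indic.
  rewrite integral_indic // setIC EFinM -muleA lee_wpmul2l //.
  exact: dom.
have [mu' mu'E] := sigma_finite_measure_of haar_sigma_finite.
have int_eq A (g : borel W -> \bar R) : (\int[mu']_(x in A) g x = \int[mu]_(x in A) g x)%E.
  by apply: eq_measure_integral => B _ _; exact: mu'E.
have [f [mf fint fC fla]] : exists f : borel W -> R, [/\ measurable_fun setT f,
    mu'.-integrable setT (EFin \o f), forall x, `|f x| <= M%:R * C * \1_K x &
    forall A, measurable A -> la A = (\int[mu']_(x in A) (f x)%:E)%E].
  apply: bounded_density => //; rewrite ?mu'E ?mulr_ge0 // => A mA.
  by rewrite mu'E; exact: la_le.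
exists f, (M%:R * C), K; split; rewrite ?mulr_ge0 //; split => //.
- apply/integrableP; split; first exact/measurable_EFinP.
  by move/integrableP : fint => [_]; rewrite int_eq.
- by move=> A mA; rewrite -laE fla // int_eq.
Qed.

End Density.

(** * Complex densities and their L^r norms *)

Lemma normc_le (R : rcfType) (x y : R) :
  ComplexField.Normc.normc (x +i* y)%C <= `|x| + `|y|.
Proof.
have xy0 : 0 <= `|x| + `|y| by exact: addr_ge0.
rewrite /= -(@ler_pXn2r _ 2) ?nnegrE ?sqrtr_ge0 // sqr_sqrtr ?addr_ge0 ?sqr_ge0 //.
rewrite -(real_normK (num_real x)) -(real_normK (num_real y)) sqrrD lerD2r lerDl.
by rewrite mulrn_wge0 // mulr_ge0.
Qed.

(** The r-th power of the modulus is at most C^r on [K] and zero elsewhere, and [K] has finite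
    measure. *)
Lemma bounded_cLspace d (T : measurableType d) (R : realType)
    (mu : {measure set T -> \bar R}) (f g : T -> R) (K : set T) (C r : R) :
  measurable_fun setT f -> measurable_fun setT g -> measurable K ->
  (mu K < +oo)%E -> 0 <= C -> 0 < r ->
  (forall x, `|f x| + `|g x| <= C * \1_K x) ->
  cLspace mu r (fun x => (f x +i* g x)%C).
Proof.
move=> mf mg mK muK C0 r0 fgC; split; first by [].
rewrite /finite_norm unlock; apply: poweR_lty.
have mn : measurable_fun setT (fun x => ComplexField.Normc.normc (f x +i* g x)%C).
  apply: (measurableT_comp (f := @Num.sqrt R)).
    by apply: continuous_measurable_fun; exact: sqrt_continuous.
  by apply: measurable_funD; exact: measurable_funX.
apply: (@le_lt_trans _ _ (\int[mu]_x ((C `^ r) * \1_K x)%:E)%E).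
  apply: ge0_le_integral => //.
  - by move=> x _; exact: poweR_ge0.
  - apply: (measurableT_comp (measurable_poweR r)); apply: measurableT_comp => //.
    exact/measurable_EFinP.
  - by apply/measurable_EFinP; apply: measurable_funM => //; exact: measurable_indic.
  move=> x _ /=; rewrite lee_fin; have := le_trans (normc_le (f x) (g x)) (fgC x).
  rewrite indicE; case: (x \in K); rewrite ?mulr1 ?mulr0 => h.
    apply: ge0_ler_powR; rewrite ?nnegrE //; first exact: ltW.
    by rewrite ger0_norm ?sqrtr_ge0.
  (* Outside [K] the integrand is 0^r, which is 0 because r > 0. *)
  rewrite (_ : Num.sqrt _ = 0) ?normr0 ?powR0 ?gt_eqF //.
  by apply/eqP; rewrite eq_le h sqrtr_ge0.
have [_ ->] // := integrable_indicZ (mu := mu) mK muK (powR_ge0 C r).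
by rewrite setTI lte_mul_pinfty // ?lee_fin ?powR_ge0.
Qed.

Theorem theoremD (R : realType) (k : finFieldType) (n : nat) (n_ge1 : (1 <= n)%N)
    (i : nat)
    (resolution : admits_strong_resolution (fpow (chevalley_morphism k n) i))
    (mu_c : {measure set (borel 'rV[laurent k]_n) -> \bar R})
    (mu_c_haar : haar_measure mu_c)
    (mu : set (borel 'M[laurent k]_n) -> R[i])
    (mu_smooth : smooth_compactly_supported mu) :
  exists f : borel 'rV[laurent k]_n -> R[i],
    (forall r : R, 1 <= r < i%:R -> cLspace mu_c r f) /\
    has_density (fun B : set (borel 'rV[laurent k]_n) =>
      mu (@chevalley (laurent k) n @^-1` B)) f mu_c.
Proof.
case: n n_ge1 resolution mu_c mu_c_haar mu mu_smooth => // n _ _ mu_c hmu mu.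
move=> [phi [nu [lc cS hnu [ire iim muE]]]].
pose S := closure [set x | phi x <> 0].
(* Here [g] stands for the real or the imaginary part; the two are pushed forward separately. *)
have S0 (g : R[i] -> R) : g 0 = 0 -> exists2 K, compact K & forall x, ~ K x -> g (phi x) = 0.
  move=> g0; exists S => // x nS; suff -> : phi x = 0 by [].
  by apply: contrapT => px; apply: nS; exact: subset_closure.
have lcg (g : R[i] -> R) x : \forall y \near x, g (phi y) = g (phi x).
  by apply: filterS (lc x) => y ->.
have [f [C [K [mf mK muK C0 [intf fC fE]]]]] :=
  chevalley_pushforward_density hmu hnu (lcg (@complex.Re R)) (S0 (@complex.Re R) erefl) ire.
have [g [C' [K' [mg mK' muK' C'0 [intg gC gE]]]]] :=
  chevalley_pushforward_density hmu hnu (lcg (@complex.Im R)) (S0 (@complex.Im R) erefl) iim.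
exists (fun x => (f x +i* g x)%C); split.
  move=> r /andP[r1 _]; have r0 : 0 < r by exact: lt_le_trans r1.
  (* The bounds of the two parts are added: both hold with the indicator of the union of [K] and
     [K']. *)
  apply: (@bounded_cLspace _ _ _ mu_c f g (K `|` K') (C + C')) => //.
  - exact: measurableU.
  - by apply: le_lt_trans (measureU2 _ mK mK') _; exact: lte_add_pinfty.
  - exact: addr_ge0.
  have le1 (X : set (borel 'rV[laurent k]_n.+1)) x : X `<=` K `|` K' ->
      \1_X x <= \1_(K `|` K') x :> R.
    move=> XK; rewrite !indicE ler_nat; case: (boolP (x \in X)) => // /set_mem/XK xK.
    by rewrite mem_set.
  move=> x; rewrite mulrDl; apply: lerD.
    by apply: le_trans (fC x) _; apply: ler_wpM2l => //; apply: le1; exact: subsetUl.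
  by apply: le_trans (gC x) _; apply: ler_wpM2l => //; apply: le1; exact: subsetUr.
split => // A mA; rewrite muE.
  by rewrite /Rintegral fE // gE.
by rewrite -[X in measurable X]setTI; exact: (@chevalley_measurable k n).
Qed.
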